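(* Let $\mathcal{A}$ be a $C^*$-algebra, let $\mathcal{M}$ and $\mathcal{N}$ be Hilbert $C^*$-modules over $\mathcal{A}$ with $\mathcal{N}$ countably generated, and let $F:\mathcal{M}\to\mathcal{N}$ be an adjointable operator. Let $B$ be the unit ball of $\mathcal{M}$. Then $F$ is $\mathcal{A}$-compact if and only if $F(B)$ is $(\mathcal{N},\mathcal{N})$-totally bounded.
   Context: A (right) Hilbert $C^*$-module $\mathcal{N}$ over $\mathcal{A}$ carries an $\mathcal{A}$-valued inner product $\langle\cdot,\cdot\rangle$ (linear in the second variable, $\langle x,ya\rangle=\langle x,y\rangle a$), and is complete for $\|x\|=\|\langle x,x\rangle\|^{1/2}$; it is countably generated if some countable subset has dense set of $\mathcal{A}$-linear combinations. An operator is a bounded $\mathcal{A}$-linear map; it is adjointable if it has an adjoint w.r.t. the inner products. For $x\in\mathcal{N}$, $y\in\mathcal{M}$, $\theta_{x,y}:\mathcal{M}\to\mathcal{N}$ is $\theta_{x,y}(z)=x\langle y,z\rangle$; an operator is $\mathcal{A}$-compact if it lies in the norm closure of the linear span of all such $\theta_{x,y}$. Admissible systems: for a submodule $\mathcal{N}^0\subset\mathcal{N}$, a countable family $X=\{x_i\}\subset\mathcal{N}$ is $\mathcal{N}^0$-admissible if for each $x\in\mathcal{N}^0$ the partial sums of $\sum_i\langle x,x_i\rangle\langle x_i,x\rangle$ are bounded above by $\langle x,x\rangle$ (in the order of $\mathcal{A}$) and the series converges in norm. For such $X$ and a countable family $\Phi=\{\varphi_1,\varphi_2,\dots\}$ of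 states on $\mathcal{A}$, define for $x,y\in\mathcal{N}^0$ the pseudo-metric $d_{X,\Phi}(x,y)^2=\sup_k\sum_{i=k}^\infty|\varphi_k(\langle x-y,x_i\rangle)|^2$. Total boundedness: a set $Y\subset\mathcal{N}^0\subset\mathcal{N}$ is $(\mathcal{N},\mathcal{N}^0)$-totally bounded if for every $\mathcal{N}^0$-admissible $X\subset\mathcal{N}$, every countable family $\Phi$ of states on $\mathcal{A}$, and every $\varepsilon>0$ there are finitely many $y_1,\dots,y_n\in Y$ such that every $y\in Y$ satisfies $d_{X,\Phi}(y_i,y)<\varepsilon$ for some $i$. *)

(* Defs.v *)
From mathcomp Require Import all_boot all_order all_algebra.
From mathcomp Require Import all_classical all_reals all_analysis.
Import Order.TTheory GRing.Theory Num.Theory.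
From mathcomp Require Import complex.
Import numFieldNormedType.Exports.

Set Implicit Arguments.
Unset Strict Implicit.
Unset Printing Implicit Defensive.

Local Open Scope classical_set_scope.
Local Open Scope ring_scope.
Local Open Scope complex_scope.

Section CStarDefs.
Variable R : realType.
Variable A : completeNormedModType R[i].
Variables (mul : A -> A -> A) (star : A -> A).

Record is_CStar_algebra : Prop := {
  cs_mulA : forall a b c, mul a (mul b c) = mul (mul a b) c;
  cs_mulDl : forall a b c, mul (a + b) c = mul a c + mul b c;
  cs_mulDr : forall a b c, mul a (b + c) = mul a b + mul a c;
  cs_mulZl : forall (k : R[i]) a b, mul (k *: a) b = k *: mul a b;
  cs_mulZr : forall (k : R[i]) a b, mul a (k *: b) = k *: mul a b;
  cs_starK : forall a, star (star a) = a;
  cs_starD : forall a b, star (a + b) = star a + star b;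
  cs_starZ : forall (k : R[i]) a, star (k *: a) = k^* *: star a;
  cs_starM : forall a b, star (mul a b) = mul (star b) (star a);
  cs_normM : forall a b, `|mul a b| <= `|a| * `|b|;
  cs_normC : forall a, `|mul (star a) a| = `|a| ^+ 2 }.

Definition A_pos (a : A) : Prop := exists b, a = mul (star b) b.
Definition A_le (a b : A) : Prop := A_pos (b - a).

Definition is_state (phi : A -> R[i]) : Prop :=
  [/\ forall a b, phi (a + b) = phi a + phi b,
      forall (k : R[i]) a, phi (k *: a) = k * phi a,
      forall b, 0 <= phi (mul (star b) b),
      forall a, `|phi a| <= `|a| &
      forall e : R[i], 0 < e -> exists a, `|a| <= 1 /\ 1 - e < `|phi a| ].

Record is_Hilbert_module (M : completeNormedModType R[i])
    (act : M -> A -> M) (ip : M -> M -> A) : Prop := {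
  hm_actDl : forall x y a, act (x + y) a = act x a + act y a;
  hm_actDr : forall x a b, act x (a + b) = act x a + act x b;
  hm_actZl : forall (k : R[i]) x a, act (k *: x) a = k *: act x a;
  hm_actZr : forall (k : R[i]) x a, act x (k *: a) = k *: act x a;
  hm_actM : forall x a b, act (act x a) b = act x (mul a b);
  hm_ipDr : forall x y z, ip x (y + z) = ip x y + ip x z;
  hm_ipZr : forall (k : R[i]) x y, ip x (k *: y) = k *: ip x y;
  hm_ipAr : forall x y a, ip x (act y a) = mul (ip x y) a;
  hm_ipC : forall x y, ip y x = star (ip x y);
  hm_ip_pos : forall x, A_pos (ip x x);
  hm_ip_def : forall x, ip x x = 0 -> x = 0;
  hm_ip_norm : forall x, `|x| ^+ 2 = `|ip x x| }.

Definition countably_generated (M : completeNormedModType R[i])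
    (act : M -> A -> M) : Prop :=
  exists g : nat -> M, forall (x : M) (e : R[i]), 0 < e ->
    exists (n : nat) (a : nat -> A), `|x - \sum_(i < n) act (g i) (a i)| < e.

Definition adjointable_operator (M N : completeNormedModType R[i])
    (actM : M -> A -> M) (ipM : M -> M -> A)
    (actN : N -> A -> N) (ipN : N -> N -> A) (F : M -> N) : Prop :=
  [/\ forall x y, F (x + y) = F x + F y,
      forall (k : R[i]) x, F (k *: x) = k *: F x,
      forall x a, F (actM x a) = actN (F x) a,
      exists c : R[i], forall x, `|F x| <= c * `|x| &
      exists G : N -> M, forall x y, ipN (F x) y = ipM x (G y) ].

(* A-compact: norm limit of finite sums of theta_{x,y}, theta_{x,y} z = x<y,z> *)
Definition A_compact (M N : completeNormedModType R[i])
    (ipM : M -> M -> A) (actN : N -> A -> N) (F : M -> N) : Prop :=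
  forall e : R[i], 0 < e -> exists (n : nat) (xs : nat -> N) (ys : nat -> M),
    forall z, `|F z - \sum_(i < n) actN (xs i) (ipM (ys i) z)| <= e * `|z|.

Definition admissible (N : completeNormedModType R[i]) (ipN : N -> N -> A)
    (N0 : set N) (X : nat -> N) : Prop :=
  forall x, N0 x ->
    (forall n, A_le (\sum_(i < n) mul (ipN x (X i)) (ipN (X i) x)) (ipN x x)) /\
    exists l : A, forall e : R[i], 0 < e -> exists n0, forall n, (n0 <= n)%N ->
      `|\sum_(i < n) mul (ipN x (X i)) (ipN (X i) x) - l| < e.

(* d_{X,Phi}(x,y) < eps, i.e.
   sup_k sum_{i >= k} |Phi k <x - y, X i>|^2 < eps^2 *)
Definition d_lt (N : completeNormedModType R[i]) (ipN : N -> N -> A)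
    (X : nat -> N) (Phi : nat -> A -> R[i]) (x y : N) (eps : R[i]) : Prop :=
  exists delta : R[i], delta < eps ^+ 2 /\
    forall k n : nat, \sum_(k <= i < n) `|Phi k (ipN (x - y) (X i))| ^+ 2 <= delta.

Definition totally_bounded (N : completeNormedModType R[i]) (ipN : N -> N -> A)
    (N0 : set N) (Y : set N) : Prop :=
  Y `<=` N0 /\
  forall X : nat -> N, admissible ipN N0 X ->
  forall Phi : nat -> A -> R[i], (forall k, is_state (Phi k)) ->
  forall eps : R[i], 0 < eps ->
    exists (n : nat) (ys : nat -> N), (forall i, (i < n)%N -> Y (ys i)) /\
      forall y, Y y -> exists i, (i < n)%N /\ d_lt ipN X Phi (ys i) y eps.

End CStarDefs.

(* Main.v *)
From HB Require Import structures.
Require Import Defs.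
From mathcomp Require Import all_boot all_order all_algebra.
From mathcomp Require Import all_classical all_reals all_analysis.
Import Order.TTheory GRing.Theory Num.Theory.
From mathcomp Require Import complex ring lra.
Import numFieldNormedType.Exports.

Set Implicit Arguments.
Unset Strict Implicit.
Unset Printing Implicit Defensive.

Local Open Scope classical_set_scope.
Local Open Scope ring_scope.
Local Open Scope complex_scope.

(** Compact implies totally bounded: for [theta_{x,y}], hence for a compact [F], the
    tails [sum_{i >= k} |phi <F z, X_i>|^2] are small uniformly in [z] in the unit
    ball and in the state [phi], because [|phi a|^2 <= phi (a a^* )]; only finitely
    many bounded coordinates remain, and these are totally bounded.

    Totally bounded implies compact: running through generators [g], each infinitely
    often, put [S_0 = 1] and [S_{n+1} = S_n - c theta_{S_n g, S_n g}]. The [S_n]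
    decrease strongly to [0] and [1 - S_n] has finite rank. If [F] is not compact,
    there are unit ball elements [z_j] and blocks [T_j = S_{n_j} - S_{n_{j+1}}] with
    [<F z_j, T_j F z_j>] bounded below in norm; by Cauchy-Schwarz for the forms
    [<., T_j .>] the vectors [T_j F z_j] are admissible up to a constant factor, and
    states attaining these norms contradict total boundedness.

    Positivity ([b^* b] is a cone, square roots, states) is established in the
    unitization, where an element [a] is positive iff it is self-adjoint and
    [|r - a| <= r] for some real [r]. *)

(** The obstacle is that norm convergence is wanted in an algebra that is neither commutative nor
    unital. Scalar estimates are run inside a state and brought back by choosing, for each index
    separately, a state that attains the norm of a positive element: a bound uniform over states is
    a norm bound. One step of the recursion does not annihilate [S_n g]; it only lowers
    [q_n = <g, S_n g>] by at least [c q_n^2]. This is why every generator has to return infinitely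
    often, and [q_n] then tends to 0 as a scalar sequence with such drops does. The shape of the
    pseudo-metric, the [k]-th state paired with the sum over [i >= k], serves both directions. Once
    tails are uniformly small, only pairs with [k, i < k0] remain. Conversely, the single term
    [i = k] separates [F z_k] from any finite net, since [<y, X_k>] tends to 0 for each fixed
    [y]. *)

Inductive lexp (K : Type) : Type :=
| LVar of nat
| LZero
| LAdd of lexp K & lexp K
| LOpp of lexp K
| LScale of K & lexp K.
Arguments LVar {K}.
Arguments LZero {K}.

Section LinearReflection.
Variables (K : nzRingType) (V : lmodType K).

Fixpoint lval (env : seq V) (e : lexp K) : V :=
  match e with
  | LVar n => nth 0 env n
  | LZero => 0
  | LAdd e1 e2 => lval env e1 + lval env e2
  | LOpp e1 => - lval env e1
  | LScale k e1 => k *: lval env e1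
  end.

Fixpoint lcoef (e : lexp K) (i : nat) : K :=
  match e with
  | LVar n => if Nat.eqb n i then 1 else 0
  | LZero => 0
  | LAdd e1 e2 => lcoef e1 i + lcoef e2 i
  | LOpp e1 => - lcoef e1 i
  | LScale k e1 => k * lcoef e1 i
  end.

(** A recursive conjunction, so that on a concrete list of atoms [cbn] unfolds it into one
    coefficient equation per atom, each left to [ring]. *)
Fixpoint all_below (P : nat -> Prop) (n : nat) : Prop :=
  if n is m.+1 then P m /\ all_below P m else True.

Lemma all_belowP (P : nat -> Prop) n : all_below P n -> forall i, (i < n)%N -> P i.
Proof.
elim: n => [|n IH] //= [Pn /IH H] i; rewrite ltnS leq_eqVlt => /orP[/eqP-> //|]; exact: H.
Qed.

Lemma lvalE env e : lval env e = \sum_(i < size env) lcoef e i *: nth 0 env i.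
Proof.
elim: e => [n||e1 IH1 e2 IH2|e1 IH1|k e1 IH1] /=.
- have [ltn|gen] := ltnP n (size env).
    rewrite (bigD1 (Ordinal ltn)) //= PeanoNat.Nat.eqb_refl scale1r big1 ?addr0 // => j.
    rewrite -val_eqE /= => jn.
    case: (PeanoNat.Nat.eqb_spec n j) => [nj|_]; last by rewrite scale0r.
    by rewrite nj eqxx in jn.
  rewrite nth_default // big1 // => j _.
  case: (PeanoNat.Nat.eqb_spec n j) => [nj|_]; last by rewrite scale0r.
  by move: gen; rewrite nj leqNgt ltn_ord.
- by rewrite big1 // => j _; rewrite scale0r.
- by rewrite IH1 IH2 -big_split; apply: eq_bigr => i _; rewrite scalerDl.
- by rewrite IH1 -sumrN; apply: eq_bigr => i _; rewrite scaleNr.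
- by rewrite IH1 scaler_sumr; apply: eq_bigr => i _; rewrite scalerA.
Qed.

Lemma lval_eq env e1 e2 :
  all_below (fun i => lcoef e1 i = lcoef e2 i) (size env) -> lval env e1 = lval env e2.
Proof.
move=> /all_belowP H; rewrite !lvalE; apply: eq_bigr => i _.
by rewrite H.
Qed.
End LinearReflection.

(* The instances hidden in two products may differ syntactically. *)
Ltac lmod_same x y :=
  first [ constr_eq x y
        | lazymatch x with
          | @GRing.mul _ ?a ?b =>
            lazymatch y with @GRing.mul _ ?c ?d => lmod_same a c; lmod_same b d end
          | @GRing.one _ => lazymatch y with @GRing.one _ => idtac end
          end ].
Ltac lmod_index x env :=
  match env with
  | ?y :: _ => let _ := match goal with _ => lmod_same x y end in constr:(0%N)
  | _ :: ?s => let n := lmod_index x s in constr:(S n)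
  end.
Ltac lmod_mem x env :=
  match env with
  | ?y :: _ => let _ := match goal with _ => lmod_same x y end in constr:(true)
  | _ :: ?s => lmod_mem x s
  | _ => constr:(false)
  end.
Ltac lmod_env V t env :=
  lazymatch t with
  | @GRing.add _ ?a ?b => let env' := lmod_env V a env in lmod_env V b env'
  | @GRing.opp _ ?a => lmod_env V a env
  | @GRing.zero _ => env
  | @GRing.scale _ _ _ ?a => lmod_env V a env
  | _ => lazymatch lmod_mem t env with
         | true => env
         | false => constr:(@cons V t env)
         end
  end.
Ltac lmod_quote K t env :=
  lazymatch t with
  | @GRing.add _ ?a ?b =>
      let x := lmod_quote K a env in let y := lmod_quote K b env in constr:(@LAdd K x y)
  | @GRing.opp _ ?a => let x := lmod_quote K a env in constr:(@LOpp K x)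
  | @GRing.zero _ => constr:(@LZero K)
  | @GRing.scale _ _ ?k ?a => let x := lmod_quote K a env in constr:(@LScale K k x)
  | _ => let n := lmod_index t env in constr:(@LVar K n)
  end.
(* Proves equalities of linear combinations by comparing the coefficients of
   the atoms with [ring]. *)
Ltac lmod_coeffs :=
  lazymatch goal with
  | |- @eq ?T ?a ?b =>
    let env := lmod_env T a (@nil T) in
    let env := lmod_env T b env in
    lazymatch constr:((fun (K : nzRingType) (V : lmodType K) (_ : V) => tt) _ _ a) with
    | (fun _ _ _ => tt) ?K ?V _ =>
      let x := lmod_quote K a env in
      let y := lmod_quote K b env in
      change (@lval K V env x = @lval K V env y);
      apply: lval_eq; cbn [size all_below lcoef Nat.eqb]
    end
  end.
Ltac lmod := lmod_coeffs; repeat (split; [ring|]); exact I.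

(** * Real-valued modulus of complex scalars *)

Section ComplexFacts.
Variable R : realType.

Definition cnorm (k : R[i]) : R := complex.Re `|k|.

Lemma cnormE (k : R[i]) : `|k| = (cnorm k)%:C.
Proof. by rewrite /cnorm normc_def. Qed.

Lemma cnorm_ge0 k : 0 <= cnorm k.
Proof. by rewrite -ler0c -cnormE. Qed.

Lemma cnorm_real (r : R) : cnorm r%:C = `|r|.
Proof. by rewrite /cnorm normc_def /= expr0n /= addr0 sqrtr_sqr. Qed.

Lemma conj_real (r : R) : Num.conj (r%:C : R[i]) = r%:C.
Proof. by apply: conj_Creal; apply/complex_realP; exists r. Qed.

Lemma nondecreasing_bounded_cauchy (t : nat -> R) (b : R) :
  (forall n, t n <= t n.+1) -> (forall n, t n <= b) ->
  forall e, 0 < e -> exists n0, forall n, (n0 <= n)%N -> t n - t n0 <= e.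
Proof.
move=> t_nd t_b e e0.
have hs : has_sup [set x | exists n, x = t n].
  split; first by exists (t 0%N); exists 0%N.
  by exists b => _ [n ->].
have [_ [n0 ->] Hn0] := sup_adherent e0 hs.
exists n0 => n _.
have : t n <= sup [set x | exists n, x = t n] by apply: sup_ubound; [exact: hs.2|exists n].
lra.
Qed.
End ComplexFacts.

(** * Unital C*-algebras *)

Section UnitalCStar.
Variables (R : realType) (U : algType R[i]) (st : U -> U) (nr : U -> R).

(** The norm is a bare real-valued function, so that the axioms can be checked for the unitization
    without a normed space structure on it. Of the C*-identity one inequality is asked; the other
    follows in [nr_sqr]. *)
Record is_unital_CStar : Prop := {
  uc_starK : forall a, st (st a) = a;
  uc_starD : forall a b, st (a + b) = st a + st b;
  uc_starZ : forall (k : R[i]) a, st (k *: a) = k^* *: st a;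
  uc_starM : forall a b, st (a * b) = st b * st a;
  uc_normD : forall a b, nr (a + b) <= nr a + nr b;
  uc_normZ : forall (k : R[i]) a, nr (k *: a) = cnorm k * nr a;
  uc_normM : forall a b, nr (a * b) <= nr a * nr b;
  uc_normC : forall a, nr a ^+ 2 <= nr (st a * a);
  uc_norm0 : forall a, nr a = 0 -> a = 0;
  uc_complete : forall u : nat -> U,
    (forall e, 0 < e -> exists n0, forall n, (n0 <= n)%N -> nr (u n - u n0) <= e) ->
    exists l, forall e, 0 < e ->
      exists n0, forall n, (n0 <= n)%N -> nr (u n - l) <= e }.

Hypothesis HU : is_unital_CStar.
Let starK := uc_starK HU.
Let starD := uc_starD HU.
Let starM := uc_starM HU.
Let nrD := uc_normD HU.
Let nrM := uc_normM HU.
Let nrC := uc_normC HU.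

Lemma ust_real (r : R) a : st (r%:C *: a) = r%:C *: st a.
Proof. by rewrite (uc_starZ HU) conj_real. Qed.

Lemma ustN a : st (- a) = - st a.
Proof.
rewrite -scaleN1r.
have -> : -1 = (-1 : R)%:C :> R[i] by rewrite rmorphN rmorph1.
by rewrite ust_real rmorphN rmorph1 scaleN1r.
Qed.

Lemma ustB a b : st (a - b) = st a - st b.
Proof. by rewrite starD ustN. Qed.

Lemma ust1 : st 1 = 1.
Proof. by rewrite -[st 1]mul1r -[X in X * _]starK -starM mul1r starK. Qed.

Lemma ust0 : st 0 = 0.
Proof. by rewrite -(subrr 1) ustB !subrr. Qed.

Lemma nr_real (r : R) a : nr (r%:C *: a) = `|r| * nr a.
Proof. by rewrite (uc_normZ HU) cnorm_real. Qed.

Lemma nr0 : nr 0 = 0.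
Proof.
have := nr_real 0 0.
by rewrite normr0 mul0r rmorph0 scale0r.
Qed.

Lemma nrN a : nr (- a) = nr a.
Proof.
rewrite -scaleN1r.
have -> : -1 = (-1 : R)%:C :> R[i] by rewrite rmorphN rmorph1.
by rewrite nr_real normrN1 mul1r.
Qed.

Lemma nr_ge0 a : 0 <= nr a.
Proof. by have := nrD a (- a); rewrite subrr nr0 nrN; lra. Qed.

Lemma nrB a b : nr (a - b) <= nr a + nr b.
Proof. by have := nrD a (- b); rewrite nrN. Qed.

Lemma nr_star a : nr (st a) = nr a.
Proof.
suff H b : nr b <= nr (st b).
  by apply/eqP; rewrite eq_le H andbT -{2}(starK a) H.
have := le_trans (nrC b) (nrM (st b) b).
have := nr_ge0 b; rewrite le_eqVlt => /orP[/eqP <- _|b0]; first exact: nr_ge0.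
by rewrite expr2 ler_pM2r.
Qed.

Lemma nr_sqr a : nr (st a * a) = nr a ^+ 2.
Proof.
apply/eqP; rewrite eq_le nrC andbT.
by rewrite (le_trans (nrM _ _)) // nr_star expr2.
Qed.

Lemma nr_sa_sqr a : st a = a -> nr (a * a) = nr a ^+ 2.
Proof. by move=> {1}<-; rewrite nr_sqr. Qed.

Lemma nr1 : nr 1 = 1.
Proof.
have /eqP := nr_sa_sqr ust1.
rewrite mulr1 expr2 -{1}(mulr1 (nr 1)) -subr_eq0 -mulrBr mulf_eq0 subr_eq0.
case/orP => [/eqP/(uc_norm0 HU)/eqP|/eqP <- //]; by rewrite oner_eq0.
Qed.

Lemma nr_scal (r : R) : nr (r%:C%:A) = `|r|.
Proof. by rewrite nr_real nr1 mulr1. Qed.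

Lemma nr_small a C : (forall e, 0 < e -> nr a <= C * e) -> a = 0.
Proof.
move=> H; apply: (uc_norm0 HU).
have a0 := nr_ge0 a; apply/eqP; rewrite eq_le a0 andbT leNgt; apply/negP => agt0.
have C0 : 0 < `|C| + 1 by rewrite ltr_wpDl.
have := H (nr a / (2 * (`|C| + 1))).
have e0 : 0 < nr a / (2 * (`|C| + 1)) by rewrite divr_gt0 // mulr_gt0.
move/(_ e0); rewrite leNgt => /negP; apply.
apply: (@le_lt_trans _ _ ((`|C| + 1) * (nr a / (2 * (`|C| + 1))))).
  rewrite ler_pM2r //; apply: le_trans (ler_norm _) _; lra.
have -> : (`|C| + 1) * (nr a / (2 * (`|C| + 1))) = nr a / 2.
  by field; rewrite gt_eqF.
lra.
Qed.

(** For self-adjoint [a] the bound says that the spectrum lies between 0 and [2 r]. In this form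
    sums are settled by the triangle inequality, whereas for elements [st b * b] closure under sums
    is the hard point, reached through [Pos_star_mul] and [Pos_sqrt]. *)
Definition Pos (a : U) : Prop := st a = a /\ exists r : R, nr (r%:C%:A - a) <= r.

Definition commutes (a b : U) := a * b = b * a.

Section SquareRoot.
Variable k : U.
Hypotheses (k_sa : st k = k) (k1 : nr k <= 1).

(** A fixed point [l] of [x -> (k + x^2) / 2] satisfies [(1 - l)^2 = 1 - k]. [rootbound] is the same
    iteration with the scalar 1 for [k]; it increases, stays at most 1, and majorizes both the norms
    and the increments of [rootseq]. *)
Fixpoint rootseq (n : nat) : U :=
  if n is m.+1 then (2^-1)%:C *: (k + rootseq m * rootseq m) else 0.
Fixpoint rootbound (n : nat) : R :=
  if n is m.+1 then 2^-1 * (1 + rootbound m * rootbound m) else 0.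

Lemma rootbound01 n : 0 <= rootbound n <= 1.
Proof. by elim: n => [|n /andP[H1 H2]] /=; [lra|nra]. Qed.

Lemma rootbound_nd n : rootbound n <= rootbound n.+1.
Proof. by have /andP[] := rootbound01 n; rewrite /=; nra. Qed.

Lemma rootseq_sa n : st (rootseq n) = rootseq n.
Proof. by elim: n => [|n IH] /=; rewrite ?ust0 // ust_real starD starM IH k_sa. Qed.

Lemma rootseq_comm z n : commutes z k -> commutes z (rootseq n).
Proof.
move=> zk; elim: n => [|n IH]; rewrite /commutes /= ?mulr0 ?mul0r //.
by rewrite -scalerAr -scalerAl mulrDr mulrDl zk mulrA IH -mulrA IH mulrA.
Qed.

Lemma nr_half a : nr ((2^-1)%:C *: a) = 2^-1 * nr a.
Proof. by rewrite nr_real ger0_norm // invr_ge0. Qed.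

Lemma nr_rootseq n : nr (rootseq n) <= rootbound n.
Proof.
elim: n => [|n IH] /=; first by rewrite nr0.
rewrite nr_half ler_pM2l ?invr_gt0 //.
apply: (le_trans (nrD _ _)); apply: lerD => //.
by apply: (le_trans (nrM _ _)); apply: ler_pM => //; exact: nr_ge0.
Qed.

Lemma rootseq_step n : nr (rootseq n.+1 - rootseq n) <= rootbound n.+1 - rootbound n.
Proof.
elim: n => [|n IH].
  by rewrite /= mul0r addr0 !subr0 nr_half; move: k1; lra.
(* Noncommutative factorization of a difference of two squares; the scalar bound obeys the same
   recursion, so the norms are compared term by term. *)
have -> : rootseq n.+2 - rootseq n.+1 = (2^-1)%:C *:
    (rootseq n.+1 * (rootseq n.+1 - rootseq n) + (rootseq n.+1 - rootseq n) * rootseq n).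
  have E m : rootseq m.+1 = (2^-1)%:C *: (k + rootseq m * rootseq m) by [].
  rewrite mulrBr mulrBl [rootseq n.+2]E [X in _ - X = _]E; lmod.
have -> : rootbound n.+2 - rootbound n.+1 =
    2^-1 * (rootbound n.+1 * (rootbound n.+1 - rootbound n)
            + (rootbound n.+1 - rootbound n) * rootbound n).
  by rewrite /=; field.
rewrite nr_half ler_pM2l ?invr_gt0 //.
apply: (le_trans (nrD _ _)); apply: lerD;
  apply: (le_trans (nrM _ _)); apply: ler_pM; rewrite ?nr_ge0 ?nr_rootseq //.
Qed.

Lemma rootseq_dist m n : (m <= n)%N ->
  nr (rootseq n - rootseq m) <= rootbound n - rootbound m.
Proof.
elim: n => [|n IH]; first by rewrite leqn0 => /eqP->; rewrite subrr nr0 subrr.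
rewrite leq_eqVlt => /orP[/eqP->|]; first by rewrite !subrr nr0.
rewrite ltnS => /IH H.
have -> : rootseq n.+1 - rootseq m = (rootseq n.+1 - rootseq n) + (rootseq n - rootseq m).
  by rewrite addrA subrK.
have := rootseq_step n; have := nrD (rootseq n.+1 - rootseq n) (rootseq n - rootseq m).
lra.
Qed.

(** Here [d] is [1 - l] for the limit [l] of [rootseq]. The bound on [1 - d] makes [d] positive with
    radius 1; the commutation clause, inherited from the iterates, is what later makes roots of
    commuting elements commute. *)
Lemma sqrt_one_minus : exists d, [/\ st d = d, d * d = 1 - k, nr (1 - d) <= 1 &
  forall z, commutes z k -> commutes z d].
Proof.
have [] := uc_complete HU (u := rootseq).
  move=> e e0.
  have [n0 Hn0] := nondecreasing_bounded_cauchy rootbound_nd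
    (fun n => proj2 (andP (rootbound01 n))) e0.
  by exists n0 => n nn0; exact: le_trans (rootseq_dist nn0) (Hn0 _ nn0).
move=> l Hl.
have l1 : nr l <= 1.
  rewrite -[1]addr0; apply/ler_addgt0Pl => e e0.
  have [n /(_ n (leqnn n)) Hn] := Hl _ e0.
  have := nrB (rootseq n) (rootseq n - l); rewrite subKr.
  have := nr_rootseq n; have /andP[] := rootbound01 n; lra.
have lE : l + l = k + l * l.
  apply/eqP; rewrite -subr_eq0; apply/eqP; apply: (@nr_small _ 4) => e e0.
  have [n0 Hn0] := Hl _ e0.
  have H1 := Hn0 _ (leqnn n0); have H2 := Hn0 _ (leqnSn n0).
  (* For consecutive iterates [r], [r'] the recursion reads [k = 2 r' - r^2]; the three error terms
     cost [2 e + e + e]. *)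
  have -> : l + l - (k + l * l) = - (2%:C *: (rootseq n0.+1 - l))
     + (rootseq n0 * (rootseq n0 - l) + (rootseq n0 - l) * l).
    rewrite mulrBr mulrBl [rootseq n0.+1]/= scalerBr scalerA -rmorphM /= mulfV ?pnatr_eq0 //.
    rewrite scale1r; lmod.
  apply: le_trans (nrD _ _) _; rewrite nrN nr_real ger0_norm //.
  have H3 : nr (rootseq n0 * (rootseq n0 - l)) <= 1 * e.
    apply: (le_trans (nrM _ _)); apply: ler_pM; rewrite ?nr_ge0 //.
    by apply: le_trans (nr_rootseq n0) _; case/andP: (rootbound01 n0).
  have H4 : nr ((rootseq n0 - l) * l) <= e * 1.
    by apply: (le_trans (nrM _ _)); apply: ler_pM; rewrite ?nr_ge0.
  have := nrD (rootseq n0 * (rootseq n0 - l)) ((rootseq n0 - l) * l); lra.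
exists (1 - l); split.
- rewrite ustB ust1; congr (1 - _).
  apply/eqP; rewrite -subr_eq0; apply/eqP; apply: (@nr_small _ 2) => e e0.
  have [n /(_ n (leqnn n)) Hn] := Hl _ e0.
  have -> : st l - l = (rootseq n - l) - st (rootseq n - l).
    by rewrite ustB rootseq_sa; lmod.
  apply: le_trans (nrB _ _) _; rewrite nr_star; lra.
- rewrite mulrBr mulr1 mulrBl mul1r.
  have -> : k = l + l - l * l by rewrite lE addrK.
  lmod.
- by rewrite subKr.
- move=> z zk; rewrite /commutes mulrBr mulrBl mulr1 mul1r; congr (z - _).
  apply/eqP; rewrite -subr_eq0; apply/eqP; apply: (@nr_small _ (2 * nr z)) => e e0.
  have [n /(_ n (leqnn n)) Hn] := Hl _ e0.
  have -> : z * l - l * z = (rootseq n - l) * z - z * (rootseq n - l).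
    rewrite mulrBr mulrBl (rootseq_comm n zk); lmod.
  apply: le_trans (nrB _ _) _.
  have := nrM (rootseq n - l) z; have := nrM z (rootseq n - l).
  have := nr_ge0 z; nra.
Qed.
End SquareRoot.

Lemma Pos_sa a : Pos a -> st a = a.
Proof. by case. Qed.

Lemma Pos_bound a r : nr (r%:C%:A - a) <= r -> forall s : R, r <= s -> nr (s%:C%:A - a) <= s.
Proof.
move=> H s rs.
have -> : s%:C%:A - a = (s - r)%:C%:A + (r%:C%:A - a).
  lmod.
apply: le_trans (nrD _ _) _; rewrite nr_scal ger0_norm ?subr_ge0 //; lra.
Qed.

Lemma Pos0 : Pos 0.
Proof. by split; [rewrite ust0|exists 0; rewrite rmorph0 scale0r subrr nr0]. Qed.

Lemma PosD a b : Pos a -> Pos b -> Pos (a + b).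
Proof.
move=> [sa [r ra]] [sb [s rs]]; split; first by rewrite starD sa sb.
exists (r + s).
have -> : (r + s)%:C%:A - (a + b) = (r%:C%:A - a) + (s%:C%:A - b) by lmod.
by apply: le_trans (nrD _ _) _; apply: lerD.
Qed.

Lemma PosZ (t : R) a : 0 <= t -> Pos a -> Pos (t%:C *: a).
Proof.
move=> t0 [sa [r ra]]; split; first by rewrite ust_real sa.
exists (t * r).
have -> : (t * r)%:C%:A - t%:C *: a = t%:C *: (r%:C%:A - a) by lmod.
by rewrite nr_real ger0_norm // ler_wpM2l.
Qed.

Lemma Pos_sqrt a : Pos a -> exists c,
  [/\ Pos c, c * c = a & forall z, commutes z a -> commutes z c].
Proof.
move=> [sa [r ra]].
have r0 : 0 <= r by exact: le_trans (nr_ge0 _) ra.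
(* [r] may be 0, so [a] is rescaled by [r + 1]. *)
have s0 : 0 < r + 1 by rewrite ltr_wpDl.
have {ra} : nr ((r + 1)%:C%:A - a) <= r + 1 by apply: Pos_bound ra _ _; rewrite lerDl.
set s := r + 1 in s0 *; move=> ra.
have sV : s^-1%:C * s%:C = 1 :> R[i] by rewrite -rmorphM /= mulVf ?gt_eqF.
pose k := 1 - s^-1%:C *: a.
have k_sa : st k = k by rewrite ustB ust1 ust_real sa.
have k1 : nr k <= 1.
  have -> : k = s^-1%:C *: (s%:C%:A - a) by rewrite /k scalerBr scalerA sV scale1r.
  by rewrite nr_real gtr0_norm ?invr_gt0 // mulrC ler_pdivrMr // mul1r.
have [d [d_sa dd d1 d_comm]] := sqrt_one_minus k_sa k1.
exists ((Num.sqrt s)%:C *: d); split.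
- apply: PosZ; first exact: sqrtr_ge0.
  by split=> //; exists 1; rewrite rmorph1 scale1r.
- rewrite -scalerAl -scalerAr scalerA -rmorphM /= -expr2 sqr_sqrtr ?(ltW s0) // dd.
  by rewrite /k subKr scalerA mulrC sV scale1r.
- move=> z za; rewrite /commutes -scalerAl -scalerAr d_comm //.
  by rewrite /commutes /k mulrBr mulrBl mulr1 mul1r -scalerAl -scalerAr za.
Qed.

(** For [u := c + i d] commutation gives [u^* u = c^2 + d^2], and [c] is the real part of [u], hence
    no larger than [u] in norm. *)
Lemma nr_le_sum_sqr c d : st c = c -> st d = d -> commutes c d ->
  nr c ^+ 2 <= nr (c * c + d * d).
Proof.
move=> sc sd cd; pose u := c + 'i *: d.
have su : st u = c - 'i *: d by rewrite starD (uc_starZ HU) sc sd conjCi scaleNr.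
have uu : st u * u = c * c + d * d.
  have ii : 'i * 'i = -1 :> R[i] by rewrite -expr2 sqrCi.
  rewrite su mulrDr !mulrBl -!scalerAl -!scalerAr scalerA ii cd scaleN1r opprK; lmod.
rewrite -uu nr_sqr; apply: lerXn2r; rewrite ?nnegrE ?nr_ge0 //.
have -> : c = (2^-1)%:C *: (u + st u).
  have -> : u + st u = 2%:C *: c by rewrite su /u rmorph_nat; lmod.
  by rewrite scalerA -rmorphM /= mulVf ?pnatr_eq0 // scale1r.
by rewrite nr_half; have := nrD u (st u); rewrite nr_star; lra.
Qed.

(* With d = sqrt (1 - c^2), the element c + i d is unitary, so |d| <= 1. *)
Lemma nr_one_minus_sqr c : st c = c -> nr c <= 1 -> nr (1 - c * c) <= 1.
Proof.
move=> sc c1.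
have [||d [sd dd _ d_comm]] := @sqrt_one_minus (c * c).
- by rewrite starM sc.
- by rewrite nr_sa_sqr // expr2; have := nr_ge0 c; nra.
have cd : commutes d c by symmetry; apply: d_comm; rewrite /commutes mulrA.
rewrite -dd nr_sa_sqr //; apply: le_trans (nr_le_sum_sqr sd sc cd) _.
by rewrite dd subrK nr1.
Qed.

Lemma Pos_sqr c : st c = c -> Pos (c * c).
Proof.
move=> sc; split; first by rewrite starM sc.
have s0 : 0 < nr c + 1 by rewrite ltr_wpDl // nr_ge0.
set s := nr c + 1 in s0; exists (s ^+ 2).
have -> : (s ^+ 2)%:C%:A - c * c =
    (s ^+ 2)%:C *: (1 - (s^-1%:C *: c) * (s^-1%:C *: c)).
  rewrite -scalerAl -scalerAr scalerA scalerBr scalerA -!rmorphM /= -expr2.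
  by rewrite -exprMn mulfV ?gt_eqF // expr1n scale1r.
rewrite nr_real ger0_norm ?sqr_ge0 // ler_piMr ?sqr_ge0 //.
apply: nr_one_minus_sqr; first by rewrite ust_real sc.
by rewrite nr_real gtr0_norm ?invr_gt0 // mulrC ler_pdivrMr // mul1r /s lerDl.
Qed.

Lemma Pos_le_scal a : st a = a -> Pos ((nr a)%:C%:A - a).
Proof.
move=> sa; split; first by rewrite ustB ust_real ust1 sa.
by exists (nr a); rewrite subKr.
Qed.

(** [a] and [r - a] have commuting self-adjoint roots [c] and [d] with [c^2 + d^2 = r], so
    [nr_le_sum_sqr] applies. *)
Lemma Pos_nr_le_scal a r : 0 <= r -> Pos a -> Pos (r%:C%:A - a) -> nr a <= r.
Proof.
move=> r0 /Pos_sqrt[c [[sc _] cc c_comm]] /Pos_sqrt[d [[sd _] dd d_comm]].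
have cd : commutes c d.
  apply: d_comm; rewrite /commutes mulrBr mulrBl -cc mulrA; congr (_ - _).
  by rewrite -scalerAl -scalerAr mulr1 mul1r.
have := nr_le_sum_sqr sc sd cd.
by rewrite -nr_sa_sqr // cc dd addrC subrK nr_scal ger0_norm.
Qed.

Lemma Pos_nr_le a b : Pos a -> Pos (b - a) -> nr a <= nr b.
Proof.
move=> Pa Pba.
have sb : st b = b by rewrite -[b](subrK a) starD (Pos_sa Pba) (Pos_sa Pa).
apply: Pos_nr_le_scal => //; first exact: nr_ge0.
have -> : (nr b)%:C%:A - a = ((nr b)%:C%:A - b) + (b - a) by rewrite addrA subrK.
by apply: PosD => //; exact: Pos_le_scal.
Qed.

Lemma Pos_anti a : Pos a -> Pos (- a) -> a = 0.
Proof.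
move=> Pa PNa; apply: (uc_norm0 HU).
have := @Pos_nr_le a 0 Pa; rewrite sub0r nr0 => /(_ PNa).
by have := nr_ge0 a => *; apply/eqP; rewrite eq_le; apply/andP.
Qed.

Lemma sa_sqr_eq0 a : st a = a -> a * a = 0 -> a = 0.
Proof.
move=> sa aa; apply: (uc_norm0 HU); apply/eqP.
by have := nr_sa_sqr sa; rewrite aa nr0 => /esym/eqP; rewrite sqrf_eq0.
Qed.

Lemma sqr_eq0 a : st a * a = 0 -> a = 0.
Proof.
move=> aa; apply: (uc_norm0 HU); apply/eqP.
by have := nr_sqr a; rewrite aa nr0 => /esym/eqP; rewrite sqrf_eq0.
Qed.

(* [x^* x + x x^*] is twice the sum of the squares of the real and imaginary parts. *)
Lemma Pos_sqr_add_sqr x : Pos (st x * x + x * st x).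
Proof.
pose c := (2^-1)%:C *: (x + st x); pose d := (2^-1 * 'i) *: (x - st x).
have sc : st c = c by rewrite ust_real starD starK addrC.
have sd : st d = d.
  rewrite (uc_starZ HU) ustB starK rmorphM /= conjCi.
  have -> : Num.conj (2^-1 : R[i]) = 2^-1 by rewrite rmorphV ?unitfE ?pnatr_eq0 //= rmorph_nat.
  by rewrite mulrN scaleNr -scalerN opprB.
have -> : st x * x + x * st x = 2%:C *: (c * c + d * d).
  rewrite /c /d -!scalerAl -!scalerAr !scalerA.
  have -> : (2^-1)%:C * (2^-1)%:C = 4^-1 :> R[i].
    by rewrite -rmorphM /= -invfM -natrM fmorphV rmorph_nat.
  have -> : 2^-1 * 'i * (2^-1 * 'i) = - 4^-1 :> R[i].
    by rewrite mulrACA -expr2 -[in X in _ * X]expr2 sqrCi mulrN1 expr2 -invfM -natrM.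
  rewrite !(mulrDl, mulrDr) !mulrN !mulNr rmorph_nat.
  lmod_coeffs; repeat (split; [by field|]); exact I.
by apply: PosZ => //; apply: PosD; apply: Pos_sqr.
Qed.

(* For [y := x q] with [q^2 = k] one finds [y^* y = - k^2] and
   [y y^* = - (x x^* )^2], both negative, while their sum is positive. *)
Lemma star_mul_neg_eq0 x k : Pos k -> st x * x = - k -> x = 0.
Proof.
move=> Pk xk; have [q [Pq qq _]] := Pos_sqrt Pk.
have sq := Pos_sa Pq; have sk := Pos_sa Pk.
pose h := x * st x.
have sh : st h = h by rewrite starM starK.
have := Pos_sqr_add_sqr (x * q).
have -> : st (x * q) * (x * q) = - (k * k).
  by rewrite starM sq -mulrA [st x * _]mulrA xk mulNr mulrN -qq !mulrA.
have -> : x * q * st (x * q) = - (h * h).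
  by rewrite starM sq -mulrA [q * _]mulrA qq /h -!mulrA [st x * (x * _)]mulrA xk mulNr mulrN opprK.
move=> P1.
have P2 := Pos_sqr sk; have P3 := Pos_sqr sh.
have kk : k * k = 0.
  apply: Pos_anti => //.
  by have := PosD P1 P3; rewrite subrK.
apply: sqr_eq0; rewrite xk.
by rewrite (sa_sqr_eq0 sk kk) oppr0.
Qed.

(* With [u := |a| - a], where [a := b^* b] and [|a|] is the root of [a^2], the
   element [x := b u] satisfies [x^* x = - |a| u^2]. *)
Theorem Pos_star_mul b : Pos (st b * b).
Proof.
pose a := st b * b.
have sa : st a = a by rewrite starM starK.
have [m [Pm mm m_comm]] := Pos_sqrt (Pos_sqr sa).
have sm := Pos_sa Pm.
have am : commutes a m by apply: m_comm; rewrite /commutes mulrA.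
have [r [Pr rr r_comm]] := Pos_sqrt Pm.
have sr := Pos_sa Pr.
pose u := m - a.
have su : st u = u by rewrite ustB sm sa.
have ua : u * a = - (u * m).
  by rewrite /u !mulrBl mm am opprB.
have um : commutes u m by rewrite /commutes /u mulrBr mulrBl am.
have ur : commutes u r by exact: r_comm.
have au : commutes a u by rewrite /commutes /u mulrBr mulrBl am.
have uamu : st (b * u) * (b * u) = - ((r * u) * (r * u)).
  rewrite starM su -mulrA [st b * _]mulrA -/a mulrA ua mulNr um -rr.
  by rewrite -[in RHS]mulrA (mulrA u r u) ur !mulrA.
have sru : st (r * u) = r * u by rewrite starM su sr ur.
have bu0 := star_mul_neg_eq0 (Pos_sqr sru) uamu.
have ru0 : r * u = 0.
  apply: sa_sqr_eq0 => //; apply: oppr_inj.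
  by rewrite -uamu bu0 mulr0 oppr0.
have mu0 : m * u = 0 by rewrite -rr -mulrA ru0 mulr0.
have au0 : a * u = 0 by rewrite /a -mulrA bu0 mulr0.
have u0 : u = 0 by apply: sa_sqr_eq0 => //; rewrite {1}/u mulrBl mu0 au0 subr0.
by move: Pm; rewrite -[m](subrK a) -/u u0 add0r.
Qed.

Lemma Pos_conj a x : Pos a -> Pos (st x * a * x).
Proof.
move=> /Pos_sqrt[c [Pc <- _]].
have -> : st x * (c * c) * x = st (c * x) * (c * x).
  by rewrite starM (Pos_sa Pc) !mulrA.
exact: Pos_star_mul.
Qed.

Lemma PosM a b : Pos a -> Pos b -> commutes a b -> Pos (a * b).
Proof.
move=> /Pos_sqrt[c [Pc cc c_comm]] Pb ab.
have bc : commutes b c by apply: c_comm; rewrite /commutes ab.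
have -> : a * b = st c * b * c by rewrite (Pos_sa Pc) -mulrA bc mulrA cc.
exact: Pos_conj.
Qed.

Section ApproximateUnit.
Variable h : U.
Hypotheses (Ph : Pos h) (P1h : Pos (1 - h)).

Lemma comm_pow_one_minus n : commutes h ((1 - h) ^+ n).
Proof. by apply: commrX; rewrite /GRing.comm mulrBr mulrBl mulr1 mul1r. Qed.

Lemma Pos_pow_one_minus n : Pos ((1 - h) ^+ n).
Proof.
elim: n => [|n IH]; first by rewrite expr0 -[1]mulr1; exact: Pos_sqr ust1.
by rewrite exprS; apply: PosM => //; rewrite /commutes -exprS exprSr.
Qed.

Lemma Pos_one_minus_pow n : Pos (1 - (1 - h) ^+ n).
Proof.
elim: n => [|n IH]; first by rewrite expr0 subrr; exact: Pos0.
have -> : 1 - (1 - h) ^+ n.+1 = 1 - (1 - h) ^+ n + h * (1 - h) ^+ n.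
  by rewrite exprS mulrBl mul1r; lmod.
apply: PosD => //; apply: PosM; [exact: Ph|exact: Pos_pow_one_minus|].
exact: comm_pow_one_minus.
Qed.

(** As for scalars, [(n+1) h (1-h)^n] is at most the geometric sum of [h (1-h)^j] over [j <= n],
    which equals [1 - (1-h)^(n+1)]. The induction step adds the positive element
    [(n+1) h^2 (1-h)^n]. *)
Lemma Pos_mul_pow_one_minus n :
  Pos (1 - (1 - h) ^+ n.+1 - (n.+1%:R : R)%:C *: (h * (1 - h) ^+ n)).
Proof.
elim: n => [|n IH].
  rewrite expr1 expr0 mulr1 subKr rmorph1 scale1r subrr; exact: Pos0.
set s := (1 - h) ^+ n in IH *.
have -> : 1 - (1 - h) ^+ n.+2 - (n.+2%:R : R)%:C *: (h * (1 - h) ^+ n.+1) =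
  1 - (1 - h) ^+ n.+1 - (n.+1%:R : R)%:C *: (h * s) + (n.+1%:R : R)%:C *: (h * s * h).
  rewrite !exprS -/s -[in n.+2%:R]addn1 natrD rmorphD /= rmorph1.
  have -> : h * s * h = h * (h * s) by rewrite -mulrA -comm_pow_one_minus.
  rewrite !(mulrBl, mulrBr, mul1r, mulr1); lmod.
apply: PosD => //; apply: PosZ => //.
rewrite -mulrA -comm_pow_one_minus -/s mulrA; apply: PosM.
- by apply: Pos_sqr; exact: Pos_sa.
- exact: Pos_pow_one_minus.
- rewrite /commutes -mulrA (comm_pow_one_minus n) -/s mulrA (comm_pow_one_minus n).
  by rewrite -mulrA.
Qed.

Lemma nr_le_one a : Pos a -> Pos (1 - a) -> nr a <= 1.
Proof. by move=> Pa P1a; rewrite -nr1; exact: Pos_nr_le. Qed.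

Lemma nr_one_minus_pow n : nr (1 - (1 - h) ^+ n) <= 1.
Proof.
apply: nr_le_one; first exact: Pos_one_minus_pow.
by rewrite subKr; exact: Pos_pow_one_minus.
Qed.

Lemma nr_mul_pow_one_minus n : nr (h * (1 - h) ^+ n) <= (n.+1%:R)^-1.
Proof.
rewrite -[_^-1]mul1r ler_pdivlMr ?ltr0n // mulrC.
have : nr ((n.+1%:R : R)%:C *: (h * (1 - h) ^+ n)) <= 1.
  apply: nr_le_one.
    apply: PosZ => //; apply: PosM => //; first exact: Pos_pow_one_minus.
    exact: comm_pow_one_minus.
  have := PosD (Pos_mul_pow_one_minus n) (Pos_pow_one_minus n.+1).
  by rewrite addrAC subrK.
by rewrite nr_real ger0_norm.
Qed.
End ApproximateUnit.

(** With [h := a a^*] and [s := (1 - h)^n], the squared norm of [s a] is the norm of [s h s], hence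
    at most that of [h s]. Thus [1 - s], a polynomial in [h] without constant term, is a contractive
    approximate left unit for [a]. *)
Lemma approximate_unit a : nr a <= 1 -> forall n,
  nr (1 - (1 - a * st a) ^+ n) <= 1 /\
  nr ((1 - a * st a) ^+ n * a) ^+ 2 <= (n.+1%:R)^-1.
Proof.
move=> a1 n; pose h := a * st a.
have Ph : Pos h by rewrite /h -{1}[a]starK; exact: Pos_star_mul.
have h1 : nr h <= 1.
  by apply: le_trans (nrM _ _) _; rewrite nr_star mulr_ile1 ?nr_ge0.
have P1h : Pos (1 - h).
  split; first by rewrite ustB ust1 (Pos_sa Ph).
  by exists 1; rewrite rmorph1 scale1r subKr.
split; first exact: nr_one_minus_pow.
rewrite -/h; set s := (1 - h) ^+ n.
have Ps : Pos s by exact: Pos_pow_one_minus.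
rewrite -[nr (s * a)]nr_star -nr_sqr starK starM (Pos_sa Ps).
have -> : s * a * (st a * s) = s * (h * s) by rewrite /h !mulrA.
apply: (le_trans (nrM _ _)).
have s1 : nr s <= 1.
  by apply: nr_le_one Ps _; exact: Pos_one_minus_pow.
by apply: le_trans (nr_mul_pow_one_minus Ph P1h n); rewrite ler_piMl ?nr_ge0.
Qed.
End UnitalCStar.

(** * The Hahn-Banach theorem *)

Section HahnBanach.
Variables (R : realType) (V : lmodType R[i]).
Implicit Types (p q : V -> R) (x y : V).

Record sublinear p : Prop := {
  sublinearD : forall x y, p (x + y) <= p x + p y;
  sublinearZ : forall (t : R) x, 0 < t -> p (t%:C *: x) <= t * p x }.

Lemma sublinear0 p : sublinear p -> p 0 = 0.
Proof.
move=> [pD pZ]; have := pD 0 0; have := pZ 2^-1 0; rewrite scaler0 addr0 invr_gt0.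
move=> /(_ (ltr0n R 2)); lra.
Qed.

Lemma sublinear_homogeneous p (t : R) x : sublinear p -> 0 <= t -> p (t%:C *: x) = t * p x.
Proof.
move=> sp; rewrite le_eqVlt => /orP[/eqP <-|t0].
  by rewrite rmorph0 scale0r mul0r sublinear0.
apply/eqP; rewrite eq_le sublinearZ //=.
have ti : 0 < t^-1 by rewrite invr_gt0.
have := sublinearZ sp (t%:C *: x) ti.
rewrite scalerA -rmorphM /= mulVf ?gt_eqF // scale1r.
by rewrite mulrC ler_pdivlMr // mulrC.
Qed.

Lemma sublinearN p x : sublinear p -> - p (- x) <= p x.
Proof. by move=> sp; have := sublinearD sp x (- x); rewrite subrr sublinear0 //; lra. Qed.

Section Shrink.
Variables (p : V -> R) (y : V).
Hypothesis sp : sublinear p.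

Let vals x := [set r | exists2 t : R, 0 <= t & r = p (x + t%:C *: y) - t * p y].
(** The greatest sublinear functional below [p] whose value at [- y] is at most [- p y]; comparison
    with it forces a minimal functional to be additive. *)
Definition shrink x := inf (vals x).

Let vals_lb x : lbound (vals x) (- p (- x)).
Proof.
move=> _ [t t0 ->].
have := sublinearD sp (x + t%:C *: y) (- x).
rewrite addrAC subrr add0r sublinear_homogeneous //; lra.
Qed.

Let vals_inf x : has_inf (vals x).
Proof.
split; first by exists (p (x + 0%:C *: y) - 0 * p y); exists 0.
by exists (- p (- x)); exact: vals_lb.
Qed.

Lemma shrink_le_at (t : R) x : 0 <= t -> shrink x <= p (x + t%:C *: y) - t * p y.
Proof. by move=> t0; apply: inf_lbound; [exact: (vals_inf x).2|exists t]. Qed.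

Lemma shrink_le x : shrink x <= p x.
Proof. by have := @shrink_le_at 0 x; rewrite rmorph0 scale0r addr0 mul0r subr0; apply. Qed.

Lemma shrink_opp : shrink (- y) <= - p y.
Proof.
have := @shrink_le_at 1 (- y).
by rewrite rmorph1 scale1r addNr sublinear0 // mul1r sub0r; apply.
Qed.

Lemma shrink_sublinear : sublinear shrink.
Proof.
split=> [x x'|t x t0].
  apply/ler_addgt0Pl => e e0.
  have e2 : 0 < e / 2 by lra.
  have [_ [t t0 ->] Ht] := inf_adherent e2 (vals_inf x).
  have [_ [s s0 ->] Hs] := inf_adherent e2 (vals_inf x').
  have := @shrink_le_at (t + s) (x + x') (addr_ge0 t0 s0).
  have -> : x + x' + (t + s)%:C *: y = (x + t%:C *: y) + (x' + s%:C *: y) by lmod.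
  have := sublinearD sp (x + t%:C *: y) (x' + s%:C *: y).
  move: Ht Hs; rewrite -/(shrink x) -/(shrink x'); lra.
rewrite mulrC -ler_pdivrMr //; apply: lb_le_inf; first exact: (vals_inf x).1.
move=> _ [s s0 ->]; rewrite ler_pdivrMr //.
have := @shrink_le_at (t * s) (t%:C *: x) (mulr_ge0 (ltW t0) s0).
have -> : t%:C *: x + (t * s)%:C *: y = t%:C *: (x + s%:C *: y) by lmod.
rewrite (@sublinear_homogeneous p) ?(ltW t0) // => /le_trans; apply.
by rewrite le_eqVlt; apply/orP; left; apply/eqP; ring.
Qed.
End Shrink.

Section Minimal.
Variable p : V -> R.
Hypothesis sp : sublinear p.

Let below := {q : V -> R | sublinear q /\ forall x, q x <= p x}.
Let ge (a b : below) : bool := `[< forall x, sval b x <= sval a x >].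

(** Zorn's lemma for the reversed pointwise order. The pointwise infimum of a nonempty chain is
    finite because [- p (- x)] bounds every member below, and subadditive because two members of a
    chain are comparable. *)
Lemma exists_minimal_sublinear : exists q, [/\ sublinear q, forall x, q x <= p x &
  forall r, sublinear r -> (forall x, r x <= q x) -> forall x, q x <= r x].
Proof.
have pp : sublinear p /\ forall x, p x <= p x by split.
have ge_refl a : ge a a by apply/asboolP.
have ge_trans a b c : ge a b -> ge b c -> ge a c.
  by move=> /asboolP ab /asboolP bc; apply/asboolP => x; exact: le_trans (bc x) (ab x).
have [C Ctot|[q [sq qp]] qmin] := ZL_preorder (exist _ p pp : below) ge_refl ge_trans; last first.
  exists q; split => // r sr rq.
  have rP : sublinear r /\ forall x, r x <= p x.
    by split=> // x; exact: le_trans (rq x) (qp x).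
  have := qmin (exist _ r rP); rewrite /ge /= => H.
  by apply/asboolP; apply: H; apply/asboolP.
have [[a0 Ca0]|noC] := pselect (exists a, C a); last first.
  by exists (exist _ p pp) => s Cs; exfalso; apply: noC; exists s.
pose vals x := [set r | exists2 a : below, C a & r = sval a x].
pose m x := inf (vals x).
have vals_inf x : has_inf (vals x).
  split; first by exists (sval a0 x); exists a0.
  exists (- p (- x)) => _ [[q [sq qp]] _ ->] /=.
  by apply: le_trans (sublinearN _ sq); rewrite lerN2.
have m_le a x : C a -> m x <= sval a x.
  by move=> Ca; apply: inf_lbound; [exact: (vals_inf x).2|exists a].
have sm : sublinear m.
  split=> [x y|t x t0].
    apply/ler_addgt0Pl => e e0.
    have e2 : 0 < e / 2 by lra.
    have [_ [a Ca ->] Ha] := inf_adherent e2 (vals_inf x).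
    have [_ [b Cb ->] Hb] := inf_adherent e2 (vals_inf y).
    have [c [Cc ca cb]] : exists c, [/\ C c, sval c x <= sval a x & sval c y <= sval b y].
      by have [/asboolP ab|/asboolP ba] := Ctot _ _ Ca Cb; [exists b|exists a].
    have := m_le c (x + y) Cc; have := sublinearD (svalP c).1 x y.
    move: Ha Hb ca cb; rewrite -/(m x) -/(m y); lra.
  rewrite mulrC -ler_pdivrMr //; apply: lb_le_inf; first exact: (vals_inf x).1.
  move=> _ [a Ca ->]; rewrite ler_pdivrMr //.
  have := m_le a (t%:C *: x) Ca; have := sublinearZ (svalP a).1 x t0; lra.
have mP : sublinear m /\ forall x, m x <= p x.
  by split=> // x; apply: le_trans (m_le a0 x Ca0) _; exact: (svalP a0).2.
by exists (exist _ m mP) => a Ca; apply/asboolP => x /=; exact: m_le.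
Qed.
End Minimal.

(* A minimal sublinear functional [f] equals each of its [shrink f y], hence is
   superadditive. *)
Theorem hahn_banach p h : sublinear p -> exists f : V -> R,
  [/\ forall x y, f (x + y) = f x + f y,
      forall (t : R) x, f (t%:C *: x) = t * f x,
      forall x, f x <= p x & f h = p h].
Proof.
move=> sp.
(* Minimality is taken below [shrink p h] rather than [p]: this bounds [f (- h)] by [- p h] and so
   yields [f h = p h]. *)
have [f [sf fp fmin]] := exists_minimal_sublinear (shrink_sublinear h sp).
have fD x y : f (x + y) = f x + f y.
  apply/eqP; rewrite eq_le (sublinearD sf) /=.
  have := fmin _ (shrink_sublinear y sf) (shrink_le y sf) x.
  have := @shrink_le_at _ y sf 1 x (ler01).
  rewrite rmorph1 scale1r mul1r; lra.
have fN x : f (- x) = - f x.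
  by have := fD x (- x); rewrite subrr sublinear0 //; lra.
have fle x : f x <= p x by exact: le_trans (fp x) (shrink_le h sp x).
exists f; split => // [t x|].
  have [t0|t0] := leP 0 t; first exact: sublinear_homogeneous.
  have := @sublinear_homogeneous f (- t) x sf; rewrite oppr_ge0 => /(_ (ltW t0)).
  by rewrite rmorphN scaleNr fN mulNr => /oppr_inj.
apply/eqP; rewrite eq_le fle /=.
have := le_trans (fp (- h)) (shrink_opp h sp); rewrite fN; lra.
Qed.
End HahnBanach.

(** * Real-valued norms and limits of sequences *)

Lemma cauchy_seq_limit (K : numFieldType) (V : completeNormedModType K) (u : nat -> V) :
  (forall e : K, 0 < e -> exists n0, forall n, (n0 <= n)%N -> `|u n - u n0| < e) ->
  exists l, forall e : K, 0 < e -> exists n0, forall n, (n0 <= n)%N -> `|u n - l| < e.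
Proof.
move=> uC.
have /cauchy_cvgP ul : cauchy (u @ \oo).
  apply: cauchy_exP => e e0.
  have [n0 Hn0] := uC _ e0; exists (u n0), n0 => // n /= /Hn0.
  by rewrite -ball_normE /= distrC.
exists (lim (u @ \oo)) => e e0.
have /cvgrPdist_lt/(_ _ e0)[n0 _ Hn0] := ul.
by exists n0 => n /Hn0; rewrite distrC.
Qed.

Section RealNorm.
Variables (R : realType).

(** Norms take values in [R[i]]; their real part loses nothing and brings estimates within reach of
    [lra] and [nra]. *)
Definition nm (V : normedModType R[i]) (x : V) : R := complex.Re `|x|.

Section Lemmas.
Variables (V : normedModType R[i]).
Implicit Types x y : V.

Lemma nmE x : `|x| = (nm x)%:C.
Proof. by rewrite /nm RRe_real // ger0_real. Qed.

Lemma nm_ge0 x : 0 <= nm x.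
Proof. by rewrite -ler0c -nmE. Qed.

Lemma nmD x y : nm (x + y) <= nm x + nm y.
Proof. by rewrite -lecR rmorphD /= -!nmE ler_normD. Qed.

Lemma nmN x : nm (- x) = nm x.
Proof. by rewrite /nm normrN. Qed.

Lemma nmB x y : nm (x - y) <= nm x + nm y.
Proof. by rewrite -[nm y]nmN nmD. Qed.

Lemma nmZ k x : nm (k *: x) = cnorm k * nm x.
Proof. by apply: (@complexI R); rewrite rmorphM /= -cnormE -!nmE normrZ. Qed.

Lemma nmZ_real (r : R) x : nm (r%:C *: x) = `|r| * nm x.
Proof. by rewrite nmZ cnorm_real. Qed.

Lemma nm0 : nm (0 : V) = 0.
Proof. by rewrite /nm normr0. Qed.

Lemma nm_eq0 x : nm x = 0 -> x = 0.
Proof. by move=> x0; apply/eqP; rewrite -normr_eq0 nmE x0. Qed.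

End Lemmas.

Lemma gt0_complexP (e : R[i]) : 0 < e -> exists2 r : R, 0 < r & e = r%:C.
Proof.
move=> e0; have /complex_realP[r er] : e \is Num.real by rewrite gtr0_real.
by exists r => //; rewrite -ltcR rmorph0 -er.
Qed.

Lemma nm_cauchy_limit (V : completeNormedModType R[i]) (u : nat -> V) :
  (forall e : R, 0 < e -> exists n0, forall n, (n0 <= n)%N -> nm (u n - u n0) <= e) ->
  exists l, forall e : R, 0 < e -> exists n0, forall n, (n0 <= n)%N -> nm (u n - l) <= e.
Proof.
move=> uC; have [_ /gt0_complexP[e e0 ->]|l Hl] := @cauchy_seq_limit _ V u.
  have [|n0 Hn0] := uC (e / 2); first lra.
  by exists n0 => n /Hn0 H; rewrite nmE ltcR; apply: le_lt_trans H _; lra.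
exists l => e e0; have [|n0 Hn0] := Hl e%:C; first by rewrite ltcR.
by exists n0 => n /Hn0; rewrite nmE ltcR => /ltW.
Qed.

Lemma cnormD (k l : R[i]) : cnorm (k + l) <= cnorm k + cnorm l.
Proof. by rewrite -lecR rmorphD /= -!cnormE ler_normD. Qed.

Lemma cnormM (k l : R[i]) : cnorm (k * l) = cnorm k * cnorm l.
Proof. by apply: (@complexI R); rewrite rmorphM /= -!cnormE normrM. Qed.

Lemma cnorm_conj (k : R[i]) : cnorm (Num.conj k) = cnorm k.
Proof. by rewrite /cnorm norm_conjC. Qed.

Lemma cnorm_eq0 (k : R[i]) : cnorm k = 0 -> k = 0.
Proof. by move=> k0; apply/eqP; rewrite -normr_eq0 cnormE k0. Qed.

Lemma cnorm_sqr (k : R[i]) : cnorm k ^+ 2 = complex.Re k ^+ 2 + complex.Im k ^+ 2.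
Proof. by apply: (@complexI R); rewrite rmorphXn /= -cnormE -add_Re2_Im2. Qed.

Lemma cnorm_ge_Re (k : R[i]) : `|complex.Re k| <= cnorm k.
Proof.
rewrite -ler_sqr ?nnegrE ?cnorm_ge0 // cnorm_sqr real_normK ?num_real // lerDl.
exact: sqr_ge0.
Qed.

Lemma cnorm_ge_Im (k : R[i]) : `|complex.Im k| <= cnorm k.
Proof.
rewrite -ler_sqr ?nnegrE ?cnorm_ge0 // cnorm_sqr real_normK ?num_real // lerDr.
exact: sqr_ge0.
Qed.

Lemma cnorm_le (k : R[i]) : cnorm k <= `|complex.Re k| + `|complex.Im k|.
Proof.
rewrite -ler_sqr ?nnegrE ?cnorm_ge0 ?addr_ge0 // cnorm_sqr sqrrD !real_normK ?num_real //.
by rewrite lerD2r lerDl mulrn_wge0 // mulr_ge0.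
Qed.

Lemma cnorm_cauchy_limit (u : nat -> R[i]) :
  (forall e : R, 0 < e -> exists n0, forall n, (n0 <= n)%N -> cnorm (u n - u n0) <= e) ->
  exists l, forall e : R, 0 < e -> exists n0, forall n, (n0 <= n)%N -> cnorm (u n - l) <= e.
Proof.
move=> uC.
have [e e0|a Ha] := @cauchy_seq_limit R R^o (fun n => complex.Re (u n)).
  have [|n0 Hn0] := uC (e / 2); first lra.
  exists n0 => n /Hn0 H; rewrite -raddfB /=; apply: le_lt_trans (cnorm_ge_Re _) _.
  by apply: le_lt_trans H _; lra.
have [e e0|b Hb] := @cauchy_seq_limit R R^o (fun n => complex.Im (u n)).
  have [|n0 Hn0] := uC (e / 2); first lra.
  exists n0 => n /Hn0 H; rewrite -raddfB /=; apply: le_lt_trans (cnorm_ge_Im _) _.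
  by apply: le_lt_trans H _; lra.
exists (a +i* b) => e e0.
have [|n1 H1] := Ha (e / 2); first lra.
have [|n2 H2] := Hb (e / 2); first lra.
exists (maxn n1 n2) => n; rewrite geq_max => /andP[/H1 K1 /H2 K2].
apply: le_trans (cnorm_le _) _; rewrite !raddfB /=; move: K1 K2; lra.
Qed.
End RealNorm.

(** * C*-algebras and their unitization *)

Section CStarBasics.
Variables (R : realType) (A : completeNormedModType R[i]).
Variables (mul : A -> A -> A) (star : A -> A).
Hypothesis HA : is_CStar_algebra mul star.
Implicit Types a b c : A.

Lemma mul0a a : mul 0 a = 0.
Proof. by have := cs_mulZl HA 0 0 a; rewrite !scale0r. Qed.

Lemma mula0 a : mul a 0 = 0.
Proof. by have := cs_mulZr HA 0 a 0; rewrite !scale0r. Qed.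

Lemma mulNa a b : mul (- a) b = - mul a b.
Proof. by rewrite -scaleN1r (cs_mulZl HA) scaleN1r. Qed.

Lemma star_real (r : R) a : star (r%:C *: a) = r%:C *: star a.
Proof. by rewrite (cs_starZ HA) conj_real. Qed.

Lemma starN a : star (- a) = - star a.
Proof.
rewrite -scaleN1r.
have -> : -1 = (-1 : R)%:C :> R[i] by rewrite rmorphN rmorph1.
by rewrite star_real rmorphN rmorph1 scaleN1r.
Qed.

Lemma starB a b : star (a - b) = star a - star b.
Proof. by rewrite (cs_starD HA) starN. Qed.

Lemma nmM a b : nm (mul a b) <= nm a * nm b.
Proof. by rewrite -lecR rmorphM /= -!nmE (cs_normM HA). Qed.

Lemma nm_star_mul a : nm (mul (star a) a) = nm a ^+ 2.
Proof. by apply: (@complexI R); rewrite rmorphXn /= -!nmE (cs_normC HA). Qed.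

Lemma nm_star a : nm (star a) = nm a.
Proof.
suff H b : nm b <= nm (star b).
  by apply/eqP; rewrite eq_le H andbT -{2}(cs_starK HA a) H.
have := nmM (star b) b; rewrite nm_star_mul.
have := nm_ge0 b; rewrite le_eqVlt => /orP[/eqP <- _|b0]; first exact: nm_ge0.
by rewrite expr2 ler_pM2r.
Qed.

Lemma nm_mul_star a : nm (mul a (star a)) = nm a ^+ 2.
Proof. by rewrite -{1}(cs_starK HA a) nm_star_mul nm_star. Qed.
End CStarBasics.

Section Unitization.
Variables (R : realType) (A : completeNormedModType R[i]).
Variables (mul : A -> A -> A) (star : A -> A).
Hypothesis HA : is_CStar_algebra mul star.

(** The proof of the axioms is a parameter of the type, so that the algebra structure, whose laws
    depend on it, can be declared as instances. *)
Definition unitization of is_CStar_algebra mul star : Type := (A * R[i]^o)%type.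
Local Notation U := (unitization HA).
HB.instance Definition _ := GRing.Lmodule.copy U (A * R[i]^o)%type.

Definition umul (x y : U) : U :=
  (mul x.1 y.1 + x.2 *: y.1 + y.2 *: x.1, x.2 * y.2).
Definition uone : U := (0, 1).

Lemma umulA : associative umul.
Proof.
move=> [a k] [b l] [c m]; rewrite /umul /=; congr pair; last by rewrite mulrA.
rewrite !(cs_mulDl HA, cs_mulDr HA, cs_mulZl HA, cs_mulZr HA) (cs_mulA HA); lmod.
Qed.

Lemma umul1l : left_id uone umul.
Proof. by move=> [a k]; rewrite /umul /= (mul0a HA) scale1r scaler0 addr0 add0r mul1r. Qed.

Lemma umul1r : right_id uone umul.
Proof. by move=> [a k]; rewrite /umul /= (mula0 HA) scale1r scaler0 !add0r mulr1. Qed.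

Lemma umulDl : left_distributive umul +%R.
Proof.
move=> [a k] [b l] [c m]; apply: (congr2 pair); last exact: mulrDl.
rewrite /= (cs_mulDl HA); lmod.
Qed.

Lemma umulDr : right_distributive umul +%R.
Proof.
move=> [a k] [b l] [c m]; apply: (congr2 pair); last exact: mulrDr.
rewrite /= (cs_mulDr HA); lmod.
Qed.

Lemma uone_neq0 : uone != 0.
Proof. by apply/eqP => -[] /eqP; rewrite oner_eq0. Qed.

HB.instance Definition _ := GRing.Zmodule_isNzRing.Build U
  umulA umul1l umul1r umulDl umulDr uone_neq0.

Lemma uscaleAl (k : R[i]) (x y : U) : k *: (x * y) = (k *: x) * y.
Proof.
case: x y => [a l] [b m]; apply: (congr2 pair); last exact: mulrA.
rewrite /= (cs_mulZl HA) -[k *: l]/(k * l); lmod.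
Qed.

HB.instance Definition _ := GRing.Lmodule_isLalgebra.Build R[i] U uscaleAl.

Lemma uscaleAr (k : R[i]) (x y : U) : k *: (x * y) = x * (k *: y).
Proof.
case: x y => [a l] [b m]; apply: (congr2 pair); last exact: mulrCA.
rewrite /= (cs_mulZr HA) -[k *: m]/(k * m); lmod.
Qed.

HB.instance Definition _ := GRing.Lalgebra_isAlgebra.Build R[i] U uscaleAr.

Definition ustar (x : U) : U := (star x.1, Num.conj x.2).

(** Left multiplication of the unitization on its ideal [A]. *)
Definition uact (x : U) (c : A) : A := mul x.1 c + x.2 *: c.

Lemma uactM x y c : uact (x * y) c = uact x (uact y c).
Proof.
rewrite /uact /= !(cs_mulDl HA, cs_mulDr HA, cs_mulZl HA, cs_mulZr HA) (cs_mulA HA); lmod.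
Qed.

Lemma uactD x y c : uact (x + y) c = uact x c + uact y c.
Proof. by rewrite /uact /= (cs_mulDl HA); lmod. Qed.

Lemma uactZ k x c : uact (k *: x) c = k *: uact x c.
Proof. by rewrite /uact /= (cs_mulZl HA) -[k *: x.2]/(k * x.2); lmod. Qed.

Lemma uactZr k x c : uact x (k *: c) = k *: uact x c.
Proof. by rewrite /uact /= (cs_mulZr HA); lmod. Qed.

Lemma star_uact x c d : mul (star (uact x c)) d = mul (star c) (uact (ustar x) d).
Proof.
rewrite /uact /= (cs_starD HA) (cs_starM HA) (cs_starZ HA).
by rewrite (cs_mulDl HA) (cs_mulDr HA) (cs_mulZl HA) (cs_mulZr HA) (cs_mulA HA).
Qed.

Lemma uact_crude x c : nm (uact x c) <= (nm x.1 + cnorm x.2) * nm c.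
Proof.
apply: le_trans (nmD _ _) _; rewrite mulrDl nmZ lerD2r; exact: nmM HA _ _.
Qed.

Definition uopnorm (x : U) : R :=
  sup [set r | exists2 c, nm c <= 1 & r = nm (uact x c)].

Let opn_has_sup x : has_sup [set r | exists2 c, nm c <= 1 & r = nm (uact x c)].
Proof.
split; first by exists (nm (uact x 0)); exists 0 => //; rewrite nm0.
exists (nm x.1 + cnorm x.2) => _ [c c1 ->]; apply: le_trans (uact_crude _ _) _.
by rewrite ler_piMr // addr_ge0 ?nm_ge0 ?cnorm_ge0.
Qed.

Lemma nm_uact x c : nm (uact x c) <= uopnorm x * nm c.
Proof.
have := nm_ge0 c; rewrite le_eqVlt => /orP[/eqP c0|c0].
  by rewrite -c0 (nm_eq0 (esym c0)) /uact (mula0 HA) scaler0 addr0 nm0 mulr0.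
have -> : c = (nm c)%:C *: ((nm c)^-1%:C *: c).
  by rewrite scalerA -rmorphM /= mulfV ?gt_eqF // scale1r.
rewrite uactZr !nmZ_real !ger0_norm ?invr_ge0 ?(ltW c0) // mulVf ?gt_eqF // mulr1.
rewrite mulrC ler_pM2r //; apply: sup_ubound; first exact: (opn_has_sup x).2.
by eexists; last reflexivity; rewrite nmZ_real ger0_norm ?invr_ge0 ?(ltW c0) // mulVf ?gt_eqF.
Qed.

Lemma uopnorm_le x (m : R) : 0 <= m -> (forall c, nm (uact x c) <= m * nm c) -> uopnorm x <= m.
Proof.
move=> m0 H; apply: sup_le_ub; first exact: (opn_has_sup x).1.
by move=> _ [c c1 ->]; apply: le_trans (H c) _; rewrite ler_piMr.
Qed.

(* The operator norm alone is degenerate when A already has a unit; taking the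
   maximum with the character [x.2] keeps the C*-identity and definiteness. *)
Definition unorm (x : U) : R := Num.max (cnorm x.2) (uopnorm x).

Lemma unorm_le x (m : R) : 0 <= m -> cnorm x.2 <= m ->
  (forall c, nm (uact x c) <= m * nm c) -> unorm x <= m.
Proof. by move=> m0 H1 H2; rewrite /unorm ge_max H1 uopnorm_le. Qed.

Lemma cnorm_unorm x : cnorm x.2 <= unorm x.
Proof. by rewrite /unorm le_max lexx. Qed.

Lemma nm_uact_unorm x c : nm (uact x c) <= unorm x * nm c.
Proof.
apply: le_trans (nm_uact x c) _; rewrite ler_wpM2r ?nm_ge0 //.
by rewrite /unorm le_max lexx orbT.
Qed.

Lemma unorm_ge0 x : 0 <= unorm x.
Proof. exact: le_trans (cnorm_ge0 _) (cnorm_unorm x). Qed.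

(** Let [x] act on the adjoint of [x.1] and subtract the scalar part. Together with [unorm_crude]
    this makes [unorm] equivalent to the sum norm, whence definiteness and completeness. *)
Lemma nm_fst_unorm x : nm x.1 <= 2 * unorm x.
Proof.
have := nm_ge0 x.1; rewrite le_eqVlt => /orP[/eqP <-|a0].
  by rewrite mulr_ge0 ?unorm_ge0.
have H : nm x.1 ^+ 2 <= 2 * unorm x * nm x.1.
  rewrite -(nm_mul_star HA).
  have -> : mul x.1 (star x.1) = uact x (star x.1) - x.2 *: star x.1.
    by rewrite /uact addrK.
  apply: le_trans (nmB _ _) _; rewrite nmZ.
  have := nm_uact_unorm x (star x.1); rewrite (nm_star HA).
  have := ler_wpM2r (ltW a0) (cnorm_unorm x); lra.
by move: H; rewrite expr2 ler_pM2r.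
Qed.

Lemma unorm_crude x : unorm x <= nm x.1 + cnorm x.2.
Proof.
apply: unorm_le; rewrite ?addr_ge0 ?nm_ge0 ?cnorm_ge0 //.
- by rewrite lerDr nm_ge0.
- exact: uact_crude.
Qed.

Lemma unitization_CStar : is_unital_CStar ustar unorm.
Proof.
split.
- by case=> a k; rewrite /ustar /= (cs_starK HA) conjCK.
- by move=> [a k] [b l]; rewrite /ustar /= (cs_starD HA) rmorphD.
- by move=> k [b l]; rewrite /ustar /= (cs_starZ HA) rmorphM.
- move=> [a k] [b l]; apply: (congr2 pair); last by rewrite /= rmorphM mulrC.
  by rewrite /= !(cs_starD HA) !(cs_starM HA) !(cs_starZ HA) addrAC.
- move=> x y; apply: unorm_le; first by rewrite addr_ge0 ?unorm_ge0.
    by apply: le_trans (cnormD _ _) _; apply: lerD; exact: cnorm_unorm.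
  move=> c; rewrite uactD mulrDl; apply: le_trans (nmD _ _) _.
  by apply: lerD; exact: nm_uact_unorm.
- have Zle k x : unorm (k *: x) <= cnorm k * unorm x.
    apply: unorm_le; first by rewrite mulr_ge0 ?unorm_ge0 ?cnorm_ge0.
      by rewrite cnormM ler_wpM2l ?cnorm_ge0 ?cnorm_unorm.
    move=> c; rewrite uactZ nmZ -mulrA ler_wpM2l ?cnorm_ge0 //.
    exact: nm_uact_unorm.
  move=> k x; apply/eqP; rewrite eq_le Zle /=.
  have [->|kN0] := eqVneq k 0; first by rewrite cnorm_real normr0 mul0r unorm_ge0.
  have k0 : 0 < cnorm k.
    by rewrite lt_def cnorm_ge0 andbT; apply: contra kN0 => /eqP/cnorm_eq0 ->.
  have := Zle k^-1 (k *: x); rewrite scalerA mulVf // scale1r.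
  have kV : cnorm k^-1 = (cnorm k)^-1.
    apply: (mulfI (x := cnorm k)); first by rewrite gt_eqF.
    by rewrite -cnormM mulfV // mulfV ?gt_eqF // /cnorm normr1.
  by rewrite kV mulrC ler_pdivlMr // mulrC.
- move=> x y; apply: unorm_le; first by rewrite mulr_ge0 ?unorm_ge0.
    by rewrite cnormM ler_pM ?cnorm_ge0 ?cnorm_unorm.
  move=> c; rewrite uactM; apply: le_trans (nm_uact_unorm _ _) _.
  by rewrite -mulrA ler_wpM2l ?unorm_ge0 ?nm_uact_unorm.
- move=> x.
  (* For the operator part, [|x c|^2 = |c^* (x^* x c)|] is at most [|x^* x| |c|^2]; for the scalar
     part it is the identity for the complex modulus. *)
  suff H : unorm x <= Num.sqrt (unorm (ustar x * x)).
    rewrite -[X in _ <= X]sqr_sqrtr ?unorm_ge0 //.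
    by rewrite lerXn2r ?nnegrE ?unorm_ge0 ?sqrtr_ge0.
  apply: unorm_le; first exact: sqrtr_ge0.
    rewrite -[cnorm x.2]ger0_norm ?cnorm_ge0 // -sqrtr_sqr ler_wsqrtr //.
    by apply: le_trans (cnorm_unorm _); rewrite /= cnormM cnorm_conj expr2.
  move=> c; rewrite -ler_sqr ?nnegrE ?nm_ge0 ?mulr_ge0 ?sqrtr_ge0 ?nm_ge0 //.
  rewrite -(nm_star_mul HA) star_uact -uactM exprMn sqr_sqrtr ?unorm_ge0 //.
  apply: le_trans (nmM HA _ _) _; rewrite (nm_star HA) expr2 mulrCA.
  by rewrite ler_wpM2l ?nm_ge0 ?nm_uact_unorm.
- move=> [a k] x0.
  have := nm_fst_unorm (a, k); have := cnorm_unorm (a, k); rewrite x0 mulr0 /= => H1 H2.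
  have -> : a = 0 by apply: nm_eq0; apply/eqP; rewrite eq_le H2 nm_ge0.
  by have -> : k = 0 by apply: cnorm_eq0; apply/eqP; rewrite eq_le H1 cnorm_ge0.
- move=> u uC.
  have [|a Ha] := @nm_cauchy_limit _ A (fun n => (u n).1).
    move=> e e0; have [|n0 Hn0] := uC (e / 2); first lra.
    exists n0 => n /Hn0 H; have := nm_fst_unorm (u n - u n0); move: H; rewrite /=; lra.
  have [|k Hk] := @cnorm_cauchy_limit R (fun n => (u n).2).
    move=> e e0; have [n0 Hn0] := uC _ e0.
    by exists n0 => n /Hn0; exact: le_trans (cnorm_unorm (u n - u n0)).
  exists (a, k) => e e0.
  have [|n1 H1] := Ha (e / 2); first lra.
  have [|n2 H2] := Hk (e / 2); first lra.
  exists (maxn n1 n2) => n; rewrite geq_max => /andP[/H1 K1 /H2 K2].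
  have := unorm_crude (u n - (a, k)); move: K1 K2; rewrite /=; lra.
Qed.

Definition uin (a : A) : U := (a, 0).

Lemma unorm_in a : unorm (uin a) = nm a.
Proof.
apply/eqP; rewrite eq_le.
have := unorm_crude (uin a); rewrite /= cnorm_real normr0 addr0 => -> /=.
have := nm_ge0 a; rewrite [0 <= _]le_eqVlt => /orP[/eqP <-|a0]; first exact: unorm_ge0.
have := nm_uact_unorm (uin a) (star a).
by rewrite /uact scale0r addr0 (nm_mul_star HA) (nm_star HA) expr2 ler_pM2r.
Qed.

(** A square root [(b, k)] in the unitization of an element of [A] has [k^2 = 0], so it lies in [A];
    the other direction is [Pos_star_mul]. *)
Lemma A_posP a : A_pos mul star a <-> Pos ustar unorm (uin a).
Proof.
split=> [[b ->]|].
  have -> : uin (mul (star b) b) = ustar (uin b) * uin b.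
    by apply: (congr2 pair); rewrite /= ?scale0r ?addr0 ?mulr0 // conjC0 scale0r addr0.
  exact: Pos_star_mul unitization_CStar _.
move/(Pos_sqrt unitization_CStar) => [[b k] [[sb _] bb _]].
have k0 : k = 0 by apply/eqP; have /eqP := congr1 snd bb; rewrite mulf_eq0 orbb.
exists b; have := congr1 fst bb; have := congr1 fst sb.
by rewrite /= k0 scale0r !addr0 => ->.
Qed.
End Unitization.

(** * The positive cone and states *)

Section PositiveCone.
Variables (R : realType) (A : completeNormedModType R[i]).
Variables (mul : A -> A -> A) (star : A -> A).
Hypothesis HA : is_CStar_algebra mul star.
Implicit Types a b c : A.
Local Notation U := (unitization HA).
Local Notation pos := (A_pos mul star).
Local Notation uPos := (Pos (@ustar _ _ _ _ HA) (@unorm _ _ _ _ HA)).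
Local Notation inU := (@uin _ _ _ _ HA).
Let HU := unitization_CStar HA.
Let posP := A_posP HA.

Lemma uinD a b : inU (a + b) = inU a + inU b.
Proof. by apply: (congr2 pair) => //=; rewrite addr0. Qed.

Lemma uinZ k a : inU (k *: a) = k *: inU a.
Proof. by apply: (congr2 pair) => //=; rewrite -[k *: 0]/(k * 0) mulr0. Qed.

Lemma uinN a : inU (- a) = - inU a.
Proof. by rewrite -scaleN1r uinZ scaleN1r. Qed.

Lemma uinB a b : inU (a - b) = inU a - inU b.
Proof. by rewrite uinD uinN. Qed.

Lemma uinM a b : inU (mul a b) = inU a * inU b.
Proof. by apply: (congr2 pair) => /=; rewrite ?scale0r ?addr0 ?mulr0. Qed.

Lemma uin_star a : inU (star a) = ustar (inU a).
Proof. by apply: (congr2 pair) => //=; rewrite conjC0. Qed.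

Lemma umul_in (x : U) a : x * inU a = inU (uact x a).
Proof. by apply: (congr2 pair) => /=; rewrite ?scale0r ?addr0 ?mulr0. Qed.

Lemma pos_sa a : pos a -> star a = a.
Proof. by move=> [b ->]; rewrite (cs_starM HA) (cs_starK HA). Qed.

Lemma pos_star_mul a : pos (mul (star a) a).
Proof. by exists a. Qed.

Lemma pos_mul_star a : pos (mul a (star a)).
Proof. by exists (star a); rewrite (cs_starK HA). Qed.

Lemma pos0 : pos 0.
Proof. by exists 0; rewrite (mula0 HA). Qed.

Lemma posD a b : pos a -> pos b -> pos (a + b).
Proof.
by move=> /posP Pa /posP Pb; apply/posP; rewrite uinD; exact: PosD.
Qed.

Lemma posZ (t : R) a : 0 <= t -> pos a -> pos (t%:C *: a).
Proof.
by move=> t0 /posP Pa; apply/posP; rewrite uinZ; exact: PosZ.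
Qed.

Lemma pos_conj_le h c : star h = h ->
  pos ((nm h)%:C *: mul (star c) c - mul (mul (star c) h) c).
Proof.
move=> sh; apply/posP; rewrite uinB uinZ !uinM uin_star.
have sU : ustar (inU h) = inU h by rewrite -uin_star sh.
have := Pos_conj HU (inU c) (Pos_le_scal HU sU).
rewrite (unorm_in HA) mulrBr mulrBl -scalerAr -scalerAl mulr1.
by [].
Qed.

Lemma nm_le_pos a b : pos a -> pos (b - a) -> nm a <= nm b.
Proof.
move=> /posP Pa /posP Pba; rewrite -!(unorm_in HA).
by apply: Pos_nr_le HU _ _ Pa _; rewrite -uinB.
Qed.

(** After scaling [a] into the unit ball, [approximate_unit] gives the estimates; its element
    [1 - s] has scalar part 0 and hence lies in [A]. *)
Lemma contractive_left_unit a (d : R) : 0 < d ->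
  exists e, nm e <= 1 /\ nm (mul e a - a) <= d.
Proof.
move=> d0.
wlog a1 : a d d0 / nm a <= 1.
  move=> H; have s0 : 0 < nm a + 1 by rewrite ltr_wpDl ?nm_ge0.
  have [||e [e1 He]] := H ((nm a + 1)^-1%:C *: a) (d / (nm a + 1)).
  - by rewrite divr_gt0.
  - rewrite nmZ_real gtr0_norm ?invr_gt0 // mulrC ler_pdivrMr // mul1r; lra.
  exists e; split=> //; move: He; rewrite (cs_mulZr HA) -scalerBr nmZ_real gtr0_norm ?invr_gt0 //.
  by rewrite mulrC ler_pM2r ?invr_gt0.
have [n Hn] : exists n : nat, (n.+1%:R : R)^-1 <= d ^+ 2.
  have d20 : 0 < d ^+ 2 by rewrite exprn_gt0.
  exists (Num.truncn (d ^+ 2)^-1); rewrite -[X in _ <= X]invrK lef_pV2 ?posrE ?invr_gt0 ?ltr0n //.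
  by apply: ltW; exact: truncnS_gt.
have := approximate_unit HU (a := inU a); rewrite (unorm_in HA) => /(_ a1 n)[H1 H2].
have pow2 m : ((1 - inU a * ustar (inU a)) ^+ m).2 = 1.
  elim: m => [|m IH]; first by rewrite expr0.
  by rewrite exprS /= IH mulr1 mul0r subr0.
have := pow2 n; set s := (1 - inU a * ustar (inU a)) ^+ n in H1 H2 * => s2.
have eE : 1 - s = inU (- s.1).
  by apply: (congr2 pair) => /=; rewrite ?sub0r // s2 subrr.
exists (- s.1); rewrite -(unorm_in HA) -eE; split=> //.
have -> : mul (- s.1) a - a = - uact s a.
  by rewrite /uact s2 scale1r (mulNa HA) opprD.
rewrite nmN -(unorm_in HA) -umul_in -ler_sqr ?nnegrE ?(ltW d0) ?unorm_ge0 //.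
exact: le_trans H2 Hn.
Qed.

Section StateInequalities.
Variable phi : A -> R[i].
Hypothesis Hphi : is_state mul star phi.

Lemma stateD a b : phi (a + b) = phi a + phi b.
Proof. by case: Hphi. Qed.

Lemma stateZ k a : phi (k *: a) = k * phi a.
Proof. by case: Hphi. Qed.

Lemma stateN a : phi (- a) = - phi a.
Proof. by rewrite -scaleN1r stateZ mulN1r. Qed.

Lemma stateB a b : phi (a - b) = phi a - phi b.
Proof. by rewrite stateD stateN. Qed.

Lemma state0 : phi 0 = 0.
Proof. by have := stateZ 0 0; rewrite scale0r mul0r. Qed.

Lemma state_sum n (F : nat -> A) m : phi (\sum_(m <= i < n) F i) = \sum_(m <= i < n) phi (F i).
Proof. by apply: (big_morph phi stateD state0). Qed.

Lemma state_pos a : pos a -> 0 <= phi a.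
Proof. by case: Hphi => _ _ H _ _ [b ->]. Qed.

Lemma state_norm a : cnorm (phi a) <= nm a.
Proof. by case: Hphi => _ _ _ H _; rewrite -lecR -cnormE -nmE. Qed.

Lemma state_Re_norm a : complex.Re (phi a) <= nm a.
Proof. by apply: le_trans (state_norm a); apply: le_trans (ler_norm _) (cnorm_ge_Re _). Qed.

Lemma state_Re_pos a : pos a -> 0 <= complex.Re (phi a).
Proof. by move/state_pos; rewrite lecE => /andP[]. Qed.

(** A nonnegative complex number has imaginary part 0; at [k = 1] and [k = i] this determines the
    imaginary and the real part of [y]. *)
Let conj_of_form (x y p q : R[i]) : 0 <= p -> 0 <= q ->
  (forall k, 0 <= Num.conj k * k * p + Num.conj k * x + k * y + q) -> y = Num.conj x.
Proof.
move=> p0 q0 form; move: p0 q0 (form 1) (form 'i) => {form}.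
rewrite conjC1 conjCi !mul1r -complexiE.
case: x => x1 x2; case: y => y1 y2; case: p => p1 p2; case: q => q1 q2.
rewrite !lecE /= => /andP[/eqP A1 _] /andP[/eqP A2 _] /andP[/eqP A3 _] /andP[/eqP A4 _].
apply/eqP; rewrite eq_complex /=; apply/andP; split; apply/eqP; lra.
Qed.

Let bound_of_form (t : R) (p q : R[i]) : 0 <= t -> 0 <= p -> complex.Re p <= 1 ->
  0 <= t%:C * p - 2%:C * t%:C + q -> t <= complex.Re q.
Proof.
case: p q => [p1 p2] [q1 q2] t0; rewrite !lecE /= => /andP[_ p0] pl1 /andP[_]; nra.
Qed.

Lemma state_cauchy_schwarz a e : nm e <= 1 ->
  cnorm (phi (mul (star a) e)) ^+ 2 <= complex.Re (phi (mul (star a) a)).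
Proof.
move=> e1.
pose p := phi (mul (star e) e); pose q := phi (mul (star a) a).
pose x := phi (mul (star e) a); pose y := phi (mul (star a) e).
have form k : 0 <= Num.conj k * k * p + Num.conj k * x + k * y + q.
  have := state_pos (pos_star_mul (k *: e + a)).
  rewrite (cs_starD HA) (cs_starZ HA) (cs_mulDl HA) !(cs_mulDr HA).
  rewrite !(cs_mulZl HA) !(cs_mulZr HA) !stateD !stateZ -/p -/q -/x -/y.
  by rewrite !addrA mulrA.
have q0 : 0 <= q by exact/state_pos/pos_star_mul.
have p0 : 0 <= p by exact/state_pos/pos_star_mul.
have p1 : complex.Re p <= 1.
  by apply: le_trans (state_Re_norm _) _; rewrite (nm_star_mul HA) expr_le1 ?nm_ge0.
have conj_y := conj_of_form p0 q0 form.
rewrite -/y -/q conj_y cnorm_conj.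
have xx : Num.conj x * x = (cnorm x ^+ 2)%:C by rewrite mulrC -normCK cnormE rmorphXn.
apply: (bound_of_form _ p0 p1); first exact: sqr_ge0.
(* The minimizing choice would be [- x / p]; as the real part of [p] is at most 1, [- x] already
   suffices and avoids a division. *)
have := form (- x); rewrite conj_y rmorphN /=.
have -> : - Num.conj x * - x * p + - Num.conj x * x + - x * Num.conj x + q =
    (cnorm x ^+ 2)%:C * p - 2%:C * (cnorm x ^+ 2)%:C + q by rewrite -xx rmorph_nat; ring.
by [].
Qed.

(** With a unit this would be [state_cauchy_schwarz] at [e = 1]. Instead, a contractive left unit
    for [a^*] up to [d] has an adjoint that acts as a right unit for [a] up to [d], and [d] is
    arbitrary. *)
Lemma state_sqr a : cnorm (phi a) ^+ 2 <= complex.Re (phi (mul a (star a))).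
Proof.
set Q := complex.Re _.
have Q0 : 0 <= Q by exact/state_Re_pos/pos_mul_star.
suff : cnorm (phi a) <= Num.sqrt Q.
  by rewrite -[X in _ -> _ <= X]sqr_sqrtr // ler_sqr ?nnegrE ?sqrtr_ge0 ?cnorm_ge0.
apply/ler_addgt0Pl => d d0.
have [e [e1 He]] := contractive_left_unit (star a) d0.
have H := @state_cauchy_schwarz (star a) (star e); rewrite (nm_star HA) (cs_starK HA) in H.
have {}H : cnorm (phi (mul a (star e))) <= Num.sqrt Q.
  by rewrite -ler_sqr ?nnegrE ?sqrtr_ge0 ?cnorm_ge0 // sqr_sqrtr //; exact: H.
have -> : a = mul a (star e) - star (mul e (star a) - star a).
  by rewrite (starB HA) (cs_starM HA) (cs_starK HA) opprB addrCA subrr addr0.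
rewrite stateB; apply: le_trans (cnormD _ _) _; rewrite addrC lerD //.
have -> : cnorm (- phi (star (mul e (star a) - star a))) = cnorm (phi (star (mul e (star a) - star a))).
  by rewrite /cnorm normrN.
by apply: le_trans (state_norm _) _; rewrite (nm_star HA).
Qed.
End StateInequalities.
End PositiveCone.

Section StateExistence.
Variables (R : realType) (A : completeNormedModType R[i]).
Variables (mul : A -> A -> A) (star : A -> A).
Hypothesis HA : is_CStar_algebra mul star.
Implicit Types a b c : A.
Local Notation U := (unitization HA).
Local Notation pos := (A_pos mul star).
Local Notation uPos := (Pos (@ustar _ _ _ _ HA) (@unorm _ _ _ _ HA)).
Local Notation inU := (@uin _ _ _ _ HA).
Let HU := unitization_CStar HA.
Let posP := A_posP HA.

Definition sapart a : A := (2^-1)%:C *: (a + star a).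

Lemma sapartD a b : sapart (a + b) = sapart a + sapart b.
Proof. by rewrite /sapart (cs_starD HA); lmod. Qed.

Lemma sapartZ (t : R) a : sapart (t%:C *: a) = t%:C *: sapart a.
Proof. by rewrite /sapart (star_real HA); lmod. Qed.

Lemma sapart_id a : star a = a -> sapart a = a.
Proof.
move=> sa; rewrite /sapart sa.
have -> : a + a = 2%:C *: a by rewrite rmorph_nat; lmod.
by rewrite scalerA -rmorphM /= mulVf ?pnatr_eq0 // scale1r.
Qed.

Lemma star_sapart a : star (sapart a) = sapart a.
Proof. by rewrite /sapart (star_real HA) (cs_starD HA) (cs_starK HA) addrC. Qed.

Lemma nm_sapart a : nm (sapart a) <= nm a.
Proof.
rewrite nmZ_real gtr0_norm ?invr_gt0 //.
have := nmD a (star a); rewrite (nm_star HA); lra.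
Qed.

(* The norm of the positive part of the self-adjoint part, computed in the unitization. *)
Let bounds a := [set t : R | 0 <= t /\ uPos (t%:C%:A - inU (sapart a))].
Let p a := inf (bounds a).

Let bounds_nm a : bounds a (nm (sapart a)).
Proof.
split; first exact: nm_ge0.
by rewrite -(unorm_in HA); apply: Pos_le_scal HU _ _; rewrite -uin_star star_sapart.
Qed.

Let bounds_inf a : has_inf (bounds a).
Proof.
by split; [exists (nm (sapart a)); exact: bounds_nm|exists 0 => t []].
Qed.

Let p_le t a : bounds a t -> p a <= t.
Proof. by move=> ta; apply: inf_lbound => //; exact: (bounds_inf a).2. Qed.

Let p_sublinear : sublinear p.
Proof.
split=> [a b|t a t0].
  apply/ler_addgt0Pl => e e0.
  have e2 : 0 < e / 2 by lra.
  have [t [t0 Pt] Ht] := inf_adherent e2 (bounds_inf a).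
  have [s [s0 Ps] Hs] := inf_adherent e2 (bounds_inf b).
  have : p (a + b) <= t + s.
    apply: p_le; split; first exact: addr_ge0.
    have -> : (t + s)%:C%:A - inU (sapart (a + b)) =
      (t%:C%:A - inU (sapart a)) + (s%:C%:A - inU (sapart b)).
      by rewrite sapartD uinD; lmod.
    exact: PosD.
  have : t < p a + e / 2 by exact: Ht.
  have : s < p b + e / 2 by exact: Hs.
  by move: (p a) (p b) (p (a + b)) => x y z {Ht Hs Pt Ps}; lra.
rewrite mulrC -ler_pdivrMr //; apply: lb_le_inf; first exact: (bounds_inf a).1.
move=> s [s0 Ps]; rewrite ler_pdivrMr //; apply: p_le; split.
  by rewrite mulr_ge0 // ltW.
have -> : (s * t)%:C%:A - inU (sapart (t%:C *: a)) = t%:C *: (s%:C%:A - inU (sapart a)).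
  by rewrite sapartZ uinZ; lmod.
by apply: PosZ => //; exact: ltW.
Qed.

Let p_le_nm a : p a <= nm a.
Proof. by apply: le_trans (nm_sapart a); apply: p_le; exact: bounds_nm. Qed.

Let p_neg a : pos (- sapart a) -> p a <= 0.
Proof.
move=> /posP Pa; apply: p_le; split=> //.
by rewrite rmorph0 scale0r sub0r -uinN.
Qed.

Let p_pos h : pos h -> nm h <= p h.
Proof.
move=> Ph; apply: lb_le_inf; first exact: (bounds_inf h).1.
move=> t [t0]; rewrite (sapart_id (pos_sa HA Ph)) -(unorm_in HA) => Pt.
by apply: Pos_nr_le_scal HU _ _ t0 _ Pt; apply/posP.
Qed.

(** Hahn-Banach for [p] gives a real-linear [f] with [f h = |h|]. As [p] is nonpositive wherever the
    self-adjoint part is negative or 0, [f] is positive and vanishes on [i] times self-adjoint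
    elements. Hence the complex-linear [f a - i f (i a)] is real and nonnegative on positive [a]. *)
Theorem exists_state h : pos h -> h <> 0 ->
  exists phi, is_state mul star phi /\ phi h = (nm h)%:C.
Proof.
move=> Ph h0; have [f [fD fZ fp fh]] := hahn_banach h p_sublinear.
have hgt0 : 0 < nm h.
  rewrite lt_def nm_ge0 andbT; apply/eqP => /nm_eq0; exact: h0.
have f0 : f 0 = 0 by have := fZ 0 0; rewrite scaler0 mul0r.
have fN a : f (- a) = - f a.
  by have := fD a (- a); rewrite subrr f0; lra.
have f_sapart0 a : sapart a = 0 -> f a = 0.
  move=> a0; have H1 : f a <= 0.
    by apply: le_trans (fp a) _; apply: p_neg; rewrite a0 oppr0; exact: pos0 HA.
  have H2 : f (- a) <= 0.
    apply: le_trans (fp _) _; apply: p_neg.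
    have -> : - a = (-1 : R)%:C *: a by rewrite rmorphN rmorph1 scaleN1r.
    by rewrite sapartZ a0 scaler0 oppr0; exact: pos0 HA.
  by rewrite fN in H2; lra.
have f_i_sa a : star a = a -> f ('i *: a) = 0.
  by move=> sa; apply: f_sapart0; rewrite /sapart (cs_starZ HA) sa conjCi scaleNr subrr scaler0.
pose phi a : R[i] := f a +i* (- f ('i *: a)).
have phiD a b : phi (a + b) = phi a + phi b.
  by rewrite /phi scalerDr !fD; apply/eqP; rewrite eq_complex /= opprD !eqxx.
have phiZ k a : phi (k *: a) = k * phi a.
  case: k => x y; rewrite /phi.
  have -> : (x +i* y) *: a = x%:C *: a + y%:C *: ('i *: a).
    rewrite scalerA -scalerDl; congr (_ *: _).
    by apply/eqP; rewrite eq_complex -complexiE /= !(mul0r, mulr0, mulr1, add0r, addr0, subr0) !eqxx.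
  have -> : 'i *: (x%:C *: a + y%:C *: ('i *: a)) = x%:C *: ('i *: a) + (- y)%:C *: a.
    rewrite scalerDr !scalerA [_ * x%:C]mulrC; congr (_ + _ *: _).
    by rewrite mulrAC -expr2 sqrCi mulN1r rmorphN.
  rewrite !fD !fZ; apply/eqP; rewrite eq_complex /=; apply/andP; split; apply/eqP; ring.
have f_le_nm a : f a <= nm a by exact: le_trans (fp a) (p_le_nm a).
exists phi; split; last first.
  rewrite /phi f_i_sa ?(pos_sa HA) // oppr0.
  by congr (_ +i* _); rewrite fh; apply/eqP; rewrite eq_le p_le_nm p_pos.
split=> //.
- move=> b; rewrite /phi f_i_sa ?(pos_sa HA (pos_star_mul _ _ b)) // oppr0 lecE /= eqxx /=.
  have : f (- mul (star b) b) <= 0.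
    apply: le_trans (fp _) _; apply: p_neg.
    rewrite sapart_id ?opprK; first exact: pos_star_mul.
    by rewrite (starN HA) (pos_sa HA (pos_star_mul _ _ b)).
  by rewrite fN oppr_le0.
- move=> a; rewrite nmE cnormE lecR.
  set z := phi a.
  (* Multiplying [a] by the conjugate of [z] makes the value of [phi] real, where it is a value of
     [f]. *)
  have H : cnorm z ^+ 2 <= cnorm z * nm a.
    have := f_le_nm (Num.conj z *: a); rewrite nmZ cnorm_conj.
    have -> : f (Num.conj z *: a) = complex.Re (phi (Num.conj z *: a)) by [].
    by rewrite phiZ -/z mulrC -normCK cnormE -rmorphXn.
  have := cnorm_ge0 z; rewrite le_eqVlt => /orP[/eqP <-|z0]; first exact: nm_ge0.
  by move: H; rewrite expr2 ler_pM2l.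
- move=> e /gt0_complexP[r r0 ->].
  exists ((nm h)^-1%:C *: h); split.
    by rewrite nmE nmZ_real gtr0_norm ?invr_gt0 // mulVf ?gt_eqF.
  have -> : phi ((nm h)^-1%:C *: h) = 1.
    rewrite phiZ /phi f_i_sa ?(pos_sa HA) // oppr0.
    have -> : f h = nm h by rewrite fh; apply/eqP; rewrite eq_le p_le_nm p_pos.
    by rewrite -[nm h +i* 0]/((nm h)%:C) -rmorphM /= mulVf ?gt_eqF.
  by rewrite normr1 ltrBlDr ltrDl ltcR.
Qed.
End StateExistence.

(** * Hilbert modules *)

Section HilbertModule.
Variables (R : realType) (A : completeNormedModType R[i]).
Variables (mul : A -> A -> A) (star : A -> A).
Hypothesis HA : is_CStar_algebra mul star.
Variables (N : completeNormedModType R[i]) (act : N -> A -> N) (ip : N -> N -> A).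
Hypothesis HN : is_Hilbert_module mul star act ip.
Implicit Types (x y z g : N) (a b : A).
Local Notation pos := (A_pos mul star).

Lemma ipNr x y : ip x (- y) = - ip x y.
Proof. by rewrite -scaleN1r (hm_ipZr HN) scaleN1r. Qed.

Lemma ipBr x y z : ip x (y - z) = ip x y - ip x z.
Proof. by rewrite (hm_ipDr HN) ipNr. Qed.

Lemma ip0r x : ip x 0 = 0.
Proof. by have := hm_ipZr HN 0 x 0; rewrite !scale0r. Qed.

Lemma ipDl x y z : ip (x + y) z = ip x z + ip y z.
Proof. by rewrite (hm_ipC HN z) (hm_ipDr HN) (cs_starD HA) -!(hm_ipC HN). Qed.

Lemma ipZl k x y : ip (k *: x) y = Num.conj k *: ip x y.
Proof. by rewrite (hm_ipC HN y) (hm_ipZr HN) (cs_starZ HA) -(hm_ipC HN). Qed.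

Lemma ipZl_real (r : R) x y : ip (r%:C *: x) y = r%:C *: ip x y.
Proof. by rewrite ipZl conj_real. Qed.

Lemma ipNl x y : ip (- x) y = - ip x y.
Proof. by rewrite (hm_ipC HN y) ipNr (starN HA) -(hm_ipC HN). Qed.

Lemma ipBl x y z : ip (x - y) z = ip x z - ip y z.
Proof. by rewrite ipDl ipNl. Qed.

Lemma ipAl x y a : ip (act x a) y = mul (star a) (ip x y).
Proof. by rewrite (hm_ipC HN y) (hm_ipAr HN) (cs_starM HA) -(hm_ipC HN). Qed.

Lemma actNl x a : act (- x) a = - act x a.
Proof. by rewrite -scaleN1r (hm_actZl HN) scaleN1r. Qed.

Lemma actBl x y a : act (x - y) a = act x a - act y a.
Proof. by rewrite (hm_actDl HN) actNl. Qed.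

Lemma nm_ip x : nm (ip x x) = nm x ^+ 2.
Proof. by apply: (@complexI R); rewrite rmorphXn /= -!nmE (hm_ip_norm HN). Qed.

Lemma ip_mulC x y : mul (ip x y) (ip y x) = mul (star (ip y x)) (ip y x).
Proof. by rewrite -(hm_ipC HN). Qed.

Lemma pos_ip_mul x y : pos (mul (ip x y) (ip y x)).
Proof. by rewrite ip_mulC; exact: pos_star_mul. Qed.

Lemma nm_ip_mul x y : nm (mul (ip x y) (ip y x)) = nm (ip x y) ^+ 2.
Proof. by rewrite ip_mulC (nm_star_mul HA) (hm_ipC HN x y) (nm_star HA). Qed.

Record pos_op (S : N -> N) : Prop := {
  pos_opD : forall x y, S (x + y) = S x + S y;
  pos_opZ : forall k x, S (k *: x) = k *: S x;
  pos_opA : forall x a, S (act x a) = act (S x) a;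
  pos_opC : forall x y, ip (S x) y = ip x (S y);
  pos_op_pos : forall x, pos (ip x (S x)) }.

Lemma pos_opN S x : pos_op S -> S (- x) = - S x.
Proof. by move=> PS; rewrite -scaleN1r (pos_opZ PS) scaleN1r. Qed.

Lemma pos_opB S x y : pos_op S -> S (x - y) = S x - S y.
Proof. by move=> PS; rewrite (pos_opD PS) pos_opN. Qed.

Lemma pos_op_id : pos_op id.
Proof. by split=> // x; exact: hm_ip_pos HN x. Qed.

(* Evaluate the form at [x - g (c w)] with [w = <S g, x>]. *)
Lemma pos_op_cauchy_schwarz S (c : R) g x : pos_op S -> 0 <= c ->
  c * nm (ip g (S g)) <= 1 ->
  pos (ip x (S x) - c%:C *: mul (ip x (S g)) (ip (S g) x)).
Proof.
move=> PS c0 cg; pose w := ip (S g) x.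
have wE : ip x (S g) = star w by rewrite /w -(hm_ipC HN).
have gx : ip g (S x) = w by rewrite -(pos_opC PS).
have sg := pos_sa HA (pos_op_pos PS g).
have H1 := pos_op_pos PS (x - act g (c%:C *: w)).
have H2 := posZ HA (sqr_ge0 c) (pos_conj_le HA w sg).
have H3 : pos ((c * (1 - c * nm (ip g (S g))))%:C *: mul (star w) w).
  by apply: posZ (pos_star_mul _ _ w) => //; rewrite mulr_ge0 // subr_ge0.
have := posD HA (posD HA H1 H2) H3.
rewrite (pos_opB _ _ PS) (pos_opA PS) ipBl !ipBr !ipAl !(hm_ipAr HN) (star_real HA) gx wE.
rewrite !(cs_mulZl HA, cs_mulZr HA) (cs_mulA HA) -/w.
congr pos; rewrite rmorphXn; lmod.
Qed.

(** Positivity of the new form is exactly [pos_op_cauchy_schwarz]; the other clauses are formal. *)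
Lemma pos_op_step S (c : R) g : pos_op S -> 0 <= c -> c * nm (ip g (S g)) <= 1 ->
  pos_op (fun x => S x - c%:C *: act (S g) (ip (S g) x)).
Proof.
move=> PS c0 cg; split=> [x y|k x|x a|x y|x].
- rewrite (pos_opD PS) (hm_ipDr HN) (hm_actDr HN); lmod.
- rewrite (pos_opZ PS) (hm_ipZr HN) (hm_actZr HN); lmod.
- by rewrite (pos_opA PS) (hm_ipAr HN) actBl (hm_actZl HN) (hm_actM HN).
- rewrite ipBl ipBr ipZl_real (hm_ipZr HN) ipAl (hm_ipAr HN) (pos_opC PS).
  by rewrite -(hm_ipC HN).
- by rewrite ipBr (hm_ipZr HN) (hm_ipAr HN); exact: pos_op_cauchy_schwarz.
Qed.

Lemma pos_op_sub S T : pos_op S -> pos_op T ->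
  (forall x, pos (ip x (S x) - ip x (T x))) -> pos_op (fun x => S x - T x).
Proof.
move=> PS PT ST; split=> [x y|k x|x a|x y|x].
- rewrite (pos_opD PS) (pos_opD PT); lmod.
- rewrite (pos_opZ PS) (pos_opZ PT); lmod.
- by rewrite (pos_opA PS) (pos_opA PT) actBl.
- by rewrite ipBl ipBr (pos_opC PS) (pos_opC PT).
- by rewrite ipBr.
Qed.

(* [S (1 - S) = S (1 - S) S + (1 - S) S (1 - S)]. *)
Lemma pos_op_sqr_le S x : pos_op S -> (forall y, pos (ip y y - ip y (S y))) ->
  pos (ip x (S x) - ip (S x) (S x)).
Proof.
move=> PS S1.
have := posD HA (S1 (S x)) (pos_op_pos PS (x - S x)).
rewrite (pos_opB _ _ PS) ipBl !ipBr -[ip x (S (S x))](pos_opC PS).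
congr pos; lmod.
Qed.

Lemma nm_pos_op_sqr S x : pos_op S -> (forall y, pos (ip y y - ip y (S y))) ->
  nm (S x) ^+ 2 <= nm (ip x (S x)).
Proof.
move=> PS S1; rewrite -nm_ip; apply: (nm_le_pos HA (hm_ip_pos HN _)).
exact: pos_op_sqr_le.
Qed.

Lemma nm_pos_op S x : pos_op S -> (forall y, pos (ip y y - ip y (S y))) ->
  nm (S x) <= nm x.
Proof.
move=> PS S1; rewrite -ler_sqr ?nnegrE ?nm_ge0 //.
apply: le_trans (nm_pos_op_sqr _ PS S1) _; rewrite -nm_ip.
by apply: (nm_le_pos HA (pos_op_pos PS x)).
Qed.

Lemma nm_ip_le x y : nm (ip x y) <= nm x * nm y.
Proof.
have [->|y0] := eqVneq y 0; first by rewrite ip0r !nm0 mulr0.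
have ygt0 : 0 < nm y by rewrite lt_def nm_ge0 andbT; apply: contra y0 => /eqP/nm_eq0 ->.
have := @pos_op_cauchy_schwarz id (nm y ^- 2) y x pos_op_id.
rewrite nm_ip mulVf ?gt_eqF ?exprn_gt0 // => /(_ _ (lexx 1)) H.
have {}H : pos (ip x x - (nm y ^- 2)%:C *: mul (ip x y) (ip y x)).
  by apply: H; rewrite invr_ge0 exprn_ge0 ?nm_ge0.
have y2 : 0 <= nm y ^- 2 by rewrite invr_ge0 exprn_ge0 ?nm_ge0.
have := nm_le_pos HA (posZ HA y2 (pos_ip_mul x y)) H.
rewrite nmZ_real ger0_norm // nm_ip_mul nm_ip mulrC ler_pdivrMr ?exprn_gt0 // -exprMn.
by rewrite ler_sqr ?nnegrE ?mulr_ge0 ?nm_ge0.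
Qed.

Lemma nm_act x a : nm (act x a) <= nm x * nm a.
Proof.
rewrite -ler_sqr ?nnegrE ?mulr_ge0 ?nm_ge0 // -nm_ip ipAl (hm_ipAr HN) exprMn.
apply: le_trans (nmM HA _ _) _; rewrite (nm_star HA).
have := nmM HA (ip x x) a; rewrite nm_ip.
move=> /(ler_wpM2l (nm_ge0 a)); move/le_trans; apply.
by rewrite le_eqVlt; apply/orP; left; apply/eqP; ring.
Qed.
End HilbertModule.

Lemma recurrent_log2 i K : exists n0, forall n, (n0 <= n)%N ->
  (K <= \sum_(m < n) (logn 2 m.+1 == i))%N.
Proof.
have mono n0 n : (n0 <= n)%N ->
    (\sum_(m < n0) (logn 2 m.+1 == i) <= \sum_(m < n) (logn 2 m.+1 == i))%N.
  move=> n0n; rewrite -!(big_mkord xpredT (fun m => nat_of_bool (logn 2 m.+1 == i))).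
  by rewrite [X in (_ <= X)%N](big_cat_nat (leq0n n0) n0n) leq_addr.
suff [n0 Hn0] : exists n0, (K <= \sum_(m < n0) (logn 2 m.+1 == i))%N.
  by exists n0 => n /mono; exact: leq_trans.
elim: K => [|K [n0 Hn0]]; first by exists 0%N.
(* The number [2^i (2 n0 + 1)] has 2-adic valuation [i] and exceeds [n0], so it supplies an
   occurrence after the first [n0] indices. The index is one less than the number. *)
have pos_m : (0 < 2 ^ i * n0.*2.+1)%N by rewrite muln_gt0 expn_gt0.
exists (2 ^ i * n0.*2.+1)%N; rewrite -(prednK pos_m) big_ord_recr /= prednK //.
rewrite lognM ?expn_gt0 // pfactorK // logn_coprime ?coprime2n ?oddS ?odd_double //.
rewrite addn0 eqxx addn1 ltnS; apply: leq_trans Hn0 (mono _ _ _).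
rewrite -ltnS prednK //; apply: (@leq_ltn_trans n0.*2); first by rewrite -addnn leq_addr.
by apply: (@leq_trans n0.*2.+1) => //; rewrite leq_pmull // expn_gt0.
Qed.

(** * A frame from a countable generating family *)

Section Frame.
Variables (R : realType) (A : completeNormedModType R[i]).
Variables (mul : A -> A -> A) (star : A -> A).
Hypothesis HA : is_CStar_algebra mul star.
Variables (N : completeNormedModType R[i]) (act : N -> A -> N) (ip : N -> N -> A).
Hypothesis HN : is_Hilbert_module mul star act ip.
Variable gen : nat -> N.
Local Notation pos := (A_pos mul star).

(** The constant [c] of the recursion: small enough that [c |<g, S g>| <= 1] whenever [0 <= S <= 1],
    and defined also for [g = 0]. *)
Definition weight (g : N) : R := (1 + nm g ^+ 2)^-1.

(* [logn 2 n.+1] takes each value infinitely often, so each generator is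
   processed infinitely often. *)
Definition step_gen n : N := gen (logn 2 n.+1).

Fixpoint residual n (x : N) : N :=
  if n is m.+1 then
    let y := residual m (step_gen m) in
    residual m x - (weight (step_gen m))%:C *: act y (ip y x)
  else x.

(** The square root absorbs the weight into the vector, which makes [1 - residual n] a plain sum of
    operators [theta_{f,f}]. *)
Definition frame n : N := (Num.sqrt (weight (step_gen n)))%:C *: residual n (step_gen n).

Lemma weight_gt0 g : 0 < weight g.
Proof. by rewrite invr_gt0 ltr_pwDl // exprn_ge0 ?nm_ge0. Qed.

Lemma weight_nm g : weight g * nm g ^+ 2 <= 1.
Proof.
by rewrite mulrC ler_pdivrMr ?mul1r ?lerDr // ltr_pwDl // exprn_ge0 ?nm_ge0.
Qed.

Lemma residual_spec n : pos_op mul star act ip (residual n) /\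
  forall x, pos (ip x x - ip x (residual n x)).
Proof.
elim: n => [|n [PS S1]].
  by split=> [|x]; [exact: pos_op_id HN|rewrite subrr; exact: pos0 HA].
set g := step_gen n.
have cg : weight g * nm (ip g (residual n g)) <= 1.
  apply: le_trans (weight_nm g); rewrite ler_wpM2l ?(ltW (weight_gt0 _)) //.
  by rewrite -(nm_ip HN); apply: (nm_le_pos HA (pos_op_pos PS g)).
have w0 := ltW (weight_gt0 g).
split; first exact: (pos_op_step HA HN PS w0 cg).
move=> x; rewrite /= -/g (ipBr HN) (hm_ipZr HN) (hm_ipAr HN).
rewrite opprB addrCA addrC; apply: (posD HA); first exact: S1.
by apply: (posZ HA w0); exact: pos_ip_mul HN _ _.
Qed.

Lemma residual_pos n : pos_op mul star act ip (residual n).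
Proof. exact: (residual_spec n).1. Qed.

Lemma residual_le1 n x : pos (ip x x - ip x (residual n x)).
Proof. exact: (residual_spec n).2. Qed.

Lemma residual_drop n x :
  ip x (residual n x) - ip x (residual n.+1 x) =
  (weight (step_gen n))%:C *:
    mul (ip x (residual n (step_gen n))) (ip (residual n (step_gen n)) x).
Proof. by rewrite /= (ipBr HN) (hm_ipZr HN) (hm_ipAr HN) subKr. Qed.

Lemma residual_drop_pos n x : pos (ip x (residual n x) - ip x (residual n.+1 x)).
Proof.
rewrite residual_drop; apply: (posZ HA (ltW (weight_gt0 _))); exact: pos_ip_mul HN _ _.
Qed.

Lemma residual_anti m n x : (m <= n)%N ->
  pos (ip x (residual m x) - ip x (residual n x)).
Proof.
elim: n => [|n IH]; first by rewrite leqn0 => /eqP->; rewrite subrr; exact: pos0 HA.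
rewrite leq_eqVlt => /orP[/eqP->|]; first by rewrite subrr; exact: pos0 HA.
rewrite ltnS => /IH H; have := posD HA H (residual_drop_pos n x).
by rewrite addrA subrK.
Qed.

Lemma residualE n x : residual n x = x - \sum_(i < n) act (frame i) (ip (frame i) x).
Proof.
elim: n => [|n IH]; first by rewrite big_ord0 subr0.
rewrite big_ord_recr /= IH opprD addrA; congr (_ - _).
rewrite /frame (ipZl_real HA HN) (hm_actZl HN) (hm_actZr HN) scalerA -rmorphM /=.
by rewrite -expr2 sqr_sqrtr ?(ltW (weight_gt0 _)).
Qed.

Let occ i n := (\sum_(m < n) (logn 2 m.+1 == i))%N.

(* A state turns the operator inequality [q_{m+1} <= q_m - c q_m^2], valid at each
   step that processes [gen i], into one between real numbers. *)
Lemma state_residual phi i n : is_state mul star phi ->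
  weight (gen i) * (occ i n)%:R *
    complex.Re (phi (ip (gen i) (residual n (gen i)))) ^+ 2 <= nm (gen i) ^+ 2.
Proof.
move=> Hphi; set g := gen i.
pose t m := complex.Re (phi (ip g (residual m g))).
have t_anti m k : (m <= k)%N -> t k <= t m.
  move=> /(residual_anti g)/(state_Re_pos Hphi).
  by rewrite (stateB Hphi) raddfB subr_ge0.
have t_ge0 m : 0 <= t m by exact/(state_Re_pos Hphi)/(pos_op_pos (residual_pos m)).
have t0 : t 0%N <= nm g ^+ 2 by rewrite -(nm_ip HN); exact: (state_Re_norm Hphi).
(* A step [m] that processes [g] lowers [t] by at least [weight g * t m ^+ 2], hence by at least
   [weight g * t n ^+ 2] since [t] decreases; these drops telescope. *)
have H m : (m <= n)%N -> weight g * (occ i m)%:R * t n ^+ 2 <= t 0%N - t m.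
  elim: m => [|m IH] mn; first by rewrite /occ big_ord0 mulr0 mul0r subrr.
  have {}IH := IH (ltnW mn).
  have := t_anti _ _ (leqnSn m).
  rewrite /occ big_ord_recr /= -/(occ i m); case: eqP => [si|_]; last first.
    by rewrite addn0; move: IH; lra.
  have gm : step_gen m = g by rewrite /step_gen si.
  have := congr1 (fun a => complex.Re (phi a)) (residual_drop m g).
  rewrite (stateB Hphi) raddfB /= -/(t m) -/(t m.+1) gm => E _.
  have q_sa := pos_sa HA (pos_op_pos (residual_pos m) g).
  have Hs := state_sqr HA Hphi (ip g (residual m g)).
  have E2 : mul (ip g (residual m g)) (ip (residual m g) g) =
      mul (ip g (residual m g)) (star (ip g (residual m g))).
    by rewrite -(hm_ipC HN).
  rewrite E2 (stateZ Hphi) in E.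
  have {}E : t m - t m.+1 = weight g *
      complex.Re (phi (mul (ip g (residual m g)) (star (ip g (residual m g))))).
    by rewrite E; case: (phi _) => u v /=; rewrite mul0r subr0.
  have tn : t n ^+ 2 <= t m ^+ 2.
    by rewrite ler_sqr ?nnegrE ?t_ge0 // t_anti // ltnW.
  have tm : t m ^+ 2 <= cnorm (phi (ip g (residual m g))) ^+ 2.
    rewrite ler_sqr ?nnegrE ?t_ge0 ?cnorm_ge0 //.
    exact: le_trans (ler_norm _) (cnorm_ge_Re _).
  have := ler_wpM2l (ltW (weight_gt0 g)) (le_trans tn (le_trans tm Hs)).
  rewrite -E natrD mulrDr mulrDl mulr1; move: IH; lra.
have := H n (leqnn n); have := t_ge0 n; rewrite -/(t n); move: t0; lra.
Qed.

Lemma residual_gen_form i (e : R) : 0 < e -> exists n0, forall n, (n0 <= n)%N ->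
  nm (ip (gen i) (residual n (gen i))) <= e.
Proof.
move=> e0; set g := gen i.
(* After [K] visits, drops of size [weight g * e^2] would exceed the initial value, at most
   [|g|^2]. *)
pose K := (Num.truncn (nm g ^+ 2 / (weight g * e ^+ 2))).+1.
have [n0 Hn0] := recurrent_log2 i K; exists n0 => n /Hn0 Kn.
have [->|q0] := eqVneq (ip g (residual n g)) 0; first by rewrite nm0 ltW.
(* The state depends on [n], but the bound of [state_residual] is the same for all states. *)
have [phi [Hphi phiq]] := exists_state HA (pos_op_pos (residual_pos n) g) (elimN eqP q0).
have := state_residual i n Hphi; rewrite -/g phiq /= => H.
have we : 0 < weight g * e ^+ 2 by rewrite mulr_gt0 ?weight_gt0 ?exprn_gt0.
have KE : nm g ^+ 2 < K%:R * (weight g * e ^+ 2).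
  by rewrite -ltr_pdivrMr // truncnS_gt.
rewrite -ler_sqr ?nnegrE ?nm_ge0 ?(ltW e0) //.
rewrite -(ler_pM2l (weight_gt0 g)) -(@ler_pM2l _ K%:R) ?ltr0n //.
apply: le_trans (ltW KE); apply: le_trans H.
rewrite mulrA [_ * weight g]mulrC -!mulrA ler_pM2l ?weight_gt0 // ler_wpM2r ?sqr_ge0 //.
by rewrite ler_nat.
Qed.

Lemma residual_gen i (e : R) : 0 < e -> exists n0, forall n, (n0 <= n)%N ->
  nm (residual n (gen i)) <= e.
Proof.
move=> e0; have [n0 Hn0] := residual_gen_form i (exprn_gt0 2 e0).
exists n0 => n /Hn0 H; rewrite -ler_sqr ?nnegrE ?nm_ge0 ?(ltW e0) //; apply: le_trans H.
by have := nm_pos_op_sqr HA HN (gen i) (residual_pos n) (residual_le1 n).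
Qed.

Lemma residual_sum k (a : nat -> A) (e : R) : 0 < e -> exists n0, forall n, (n0 <= n)%N ->
  nm (residual n (\sum_(i < k) act (gen i) (a i))) <= e.
Proof.
elim: k e => [|k IH] e e0.
  exists 0%N => n _; rewrite big_ord0 -(scale0r 0) (pos_opZ (residual_pos n)) scale0r nm0.
  exact: ltW.
have [|n1 H1] := IH (e / 2); first lra.
have d0 : 0 < nm (a k) + 1 by rewrite ltr_wpDl ?nm_ge0.
have [|n2 H2] := residual_gen k (e := e / 2 / (nm (a k) + 1)).
  by rewrite !divr_gt0.
exists (maxn n1 n2) => n; rewrite geq_max => /andP[/H1 K1 /H2 K2].
rewrite big_ord_recr /= (pos_opD (residual_pos n)) (pos_opA (residual_pos n)).
apply: le_trans (nmD _ _) _; have := nm_act HA HN (residual n (gen k)) (a k).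
have : nm (residual n (gen k)) * nm (a k) <= e / 2.
  apply: le_trans (_ : e / 2 / (nm (a k) + 1) * (nm (a k) + 1) <= _); last by rewrite divfK ?gt_eqF.
  by apply: ler_pM; rewrite ?nm_ge0 // lerDl.
move: K1; lra.
Qed.

Hypothesis gen_dense : forall (x : N) (e : R[i]), 0 < e ->
  exists (n : nat) (a : nat -> A), `|x - \sum_(i < n) act (gen i) (a i)| < e.

(** Residuals are contractions, so convergence on the dense combinations of generators spreads to
    every [x]. *)
Lemma residual_cvg x (e : R) : 0 < e -> exists n0, forall n, (n0 <= n)%N ->
  nm (residual n x) <= e.
Proof.
move=> e0; have [|k [a Ha]] := @gen_dense x (e / 2)%:C; first by rewrite ltcR; lra.
have [|n0 Hn0] := residual_sum k a (e := e / 2); first lra.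
exists n0 => n /Hn0 H; move: Ha; rewrite nmE ltcR; set y := \sum_(i < k) _ => Ha.
rewrite -[x](subrK y) (pos_opD (residual_pos n)); apply: le_trans (nmD _ _) _.
have := nm_pos_op HA HN (x - y) (residual_pos n) (residual_le1 n).
move: H Ha; rewrite -/y; lra.
Qed.

Lemma residual_form_cvg x (e : R) : 0 < e -> exists n0, forall n, (n0 <= n)%N ->
  nm (ip x (residual n x)) <= e.
Proof.
move=> e0; have d0 : 0 < nm x + 1 by rewrite ltr_wpDl ?nm_ge0.
have [|n0 Hn0] := residual_cvg x (e := e / (nm x + 1)); first by rewrite divr_gt0.
exists n0 => n /Hn0 H; apply: le_trans (nm_ip_le HA HN _ _) _.
apply: le_trans (_ : (nm x + 1) * (e / (nm x + 1)) <= _); last by rewrite mulrC divfK ?gt_eqF.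
by apply: ler_pM; rewrite ?nm_ge0 // lerDl.
Qed.
End Frame.

(** * Totally bounded implies compact *)

Section Converse.
Variables (R : realType) (A : completeNormedModType R[i]).
Variables (mul : A -> A -> A) (star : A -> A).
Hypothesis HA : is_CStar_algebra mul star.
Variables (M N : completeNormedModType R[i]).
Variables (actM : M -> A -> M) (ipM : M -> M -> A).
Variables (actN : N -> A -> N) (ipN : N -> N -> A) (F : M -> N).
Hypothesis HM : is_Hilbert_module mul star actM ipM.
Hypothesis HN : is_Hilbert_module mul star actN ipN.
Hypothesis HF : adjointable_operator actM ipM actN ipN F.
Local Notation pos := (A_pos mul star).

Lemma operator_bound : exists2 C : R, 0 <= C & forall z, nm (F z) <= C * nm z.
Proof.
case: HF => _ _ _ [c Hc] _; exists `|complex.Re c| => // z.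
have := Hc z; rewrite !nmE; case: c {Hc} => a b; rewrite lecE /= => /andP[_].
rewrite mulr0 subr0 => /le_trans; apply.
by rewrite ler_wpM2r ?nm_ge0 ?ler_norm.
Qed.

Lemma operator0 : F 0 = 0.
Proof. by case: HF => _ FZ _ _ _; have := FZ 0 0; rewrite !scale0r. Qed.

Section Blocks.
Variable gen : nat -> N.
Hypothesis gen_dense : forall (x : N) (e : R[i]), 0 < e ->
  exists (n : nat) (a : nat -> A), `|x - \sum_(i < n) actN (gen i) (a i)| < e.
Local Notation res := (residual actN ipN gen).
Local Notation q n x := (ipN x (res n x)).

(** [F - S_n F] is the sum of [theta_{f_i, G f_i}] over the first [n] frame vectors, with [G] the
    adjoint of [F]. So [F] would be compact if some [S_n F] were small on the unit ball for every
    tolerance. *)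
Lemma not_compact_residual : ~ A_compact ipM actN F ->
  exists2 d : R, 0 < d & forall n, exists z, nm z <= 1 /\ d < nm (res n (F z)).
Proof.
move=> nc; apply: contrapT => H; apply: nc => _ /gt0_complexP[e e0 ->].
have [n Hn] : exists n, forall z, nm z <= 1 -> nm (res n (F z)) <= e.
  apply: contrapT => K; apply: H; exists e => // n.
  apply: contrapT => Kn; apply: K; exists n => z z1.
  by rewrite leNgt; apply/negP => zn; apply: Kn; exists z.
case: HF => FD FZ FA _ [G HG].
exists n, (frame actN ipN gen), (G \o frame actN ipN gen) => z.
have -> : F z - \sum_(i < n) actN (frame actN ipN gen i)
    (ipM ((G \o frame actN ipN gen) i) z) = res n (F z).
  rewrite (residualE HA HN); congr (_ - _); apply: eq_bigr => i _; congr actN.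
  by rewrite /= (hm_ipC HM z) -HG -(hm_ipC HN).
rewrite !nmE -rmorphM lecR /=.
have [->|z0] := eqVneq z 0.
  rewrite operator0 -(scale0r 0) (pos_opZ (residual_pos HA HN gen n)) scale0r.
  by rewrite !nm0 mulr0.
have zgt0 : 0 < nm z by rewrite lt_def nm_ge0 andbT; apply: contra z0 => /eqP/nm_eq0 ->.
have := Hn ((nm z)^-1%:C *: z); rewrite FZ (pos_opZ (residual_pos HA HN gen n)).
rewrite !nmZ_real gtr0_norm ?invr_gt0 // mulVf ?gt_eqF // => /(_ (lexx 1)).
by rewrite mulrC ler_pdivrMr.
Qed.

Variable C : R.
Hypotheses (C0 : 0 <= C) (FC : forall z, nm (F z) <= C * nm z).
Variables (d : R) (z : nat -> M) (nn : nat -> nat).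
Hypotheses (d0 : 0 < d) (z1 : forall j, nm (z j) <= 1) (nnS : forall j, (nn j < nn j.+1)%N).
Hypotheses (nn0 : nn 0%N = 0%N).
Hypothesis z_big : forall j, d < nm (res (nn j) (F (z j))).
Hypothesis z_small : forall j, nm (q (nn j.+1) (F (z j))) <= d ^+ 2 / 2.

Let s : R := (1 + C)^-1.
Let T j x := res (nn j) x - res (nn j.+1) x.
(** The factor [s = 1 / (1 + C)] gives [s^2 |<y, T_j y>| <= 1] for [y = F z_j], as Cauchy-Schwarz
    for the form of [T_j] requires. *)
Definition block_vector j : N := s%:C *: T j (F (z j)).
Let X := block_vector.
Let h j := ipN (F (z j)) (T j (F (z j))).

Let s_gt0 : 0 < s.
Proof. by rewrite invr_gt0 ltr_pwDl. Qed.

Let T_pos j : pos_op mul star actN ipN (T j).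
Proof.
apply: (pos_op_sub HA HN (residual_pos HA HN gen _) (residual_pos HA HN gen _)) => x.
by apply: (residual_anti HA HN); exact: ltnW.
Qed.

Let hE j : h j = q (nn j) (F (z j)) - q (nn j.+1) (F (z j)).
Proof. by rewrite /h (ipBr HN). Qed.

Lemma block_pos j : pos (h j).
Proof. exact: (pos_op_pos (T_pos j)). Qed.

(** At [y = F z_j] the form of the earlier residual exceeds [d^2], by [|S y|^2 <= |<y, S y>|]; the
    later one takes away at most [d^2 / 2]. *)
Lemma block_nm j : d ^+ 2 / 2 < nm (h j).
Proof.
have H1 : d ^+ 2 < nm (q (nn j) (F (z j))).
  apply: lt_le_trans (nm_pos_op_sqr HA HN _ (residual_pos HA HN gen _) (residual_le1 HA HN gen _)).
  by rewrite ltr_sqr ?nnegrE ?nm_ge0 ?(ltW d0).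
have := nmD (h j) (q (nn j.+1) (F (z j))); rewrite {1}hE subrK.
by move: (z_small j) H1; lra.
Qed.

Lemma block_ip j : ipN (F (z j)) (X j) = s%:C *: h j.
Proof. by rewrite /X /block_vector (hm_ipZr HN). Qed.

Let b x j := mul (ipN x (X j)) (ipN (X j) x).

(** This places [theta_{X_j, X_j}] below the block [T_j]; the blocks telescope, so sums of [b x j]
    are controlled by residuals. *)
Let b_le x j : pos (ipN x (T j x) - b x j).
Proof.
set y := F (z j).
have -> : b x j = (s ^+ 2)%:C *: mul (ipN x (T j y)) (ipN (T j y) x).
  rewrite /b /X /block_vector (hm_ipZr HN) (ipZl_real HA HN) (cs_mulZl HA) (cs_mulZr HA).
  by rewrite scalerA -rmorphM -expr2.
apply: (pos_op_cauchy_schwarz HA HN _ (T_pos j) (sqr_ge0 s)).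
have H : nm (ipN y (T j y)) <= nm y ^+ 2.
  rewrite -(nm_ip HN); apply: (nm_le_pos HA (pos_op_pos (T_pos j) y)).
  have := posD HA (residual_le1 HA HN gen (nn j) y)
     (pos_op_pos (residual_pos HA HN gen (nn j.+1)) y).
  by rewrite /T (ipBr HN) opprB; congr pos; lmod.
have yC : nm y <= C.
  by apply: le_trans (FC _) _; rewrite ler_piMr.
have sy : s * nm y <= 1.
  by rewrite mulrC ler_pdivrMr ?mul1r; [move: yC; lra|rewrite ltr_pwDl].
have := ler_wpM2l (sqr_ge0 s) H; move/le_trans; apply.
by rewrite -exprMn expr_le1 // mulr_ge0 ?nm_ge0 // ltW.
Qed.

Let b_tail x m n : (m <= n)%N ->
  pos (q (nn m) x - q (nn n) x - \sum_(m <= j < n) b x j).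
Proof.
elim: n => [|n IH].
  by rewrite leqn0 => /eqP->; rewrite subrr big_geq // subr0; exact: pos0 HA.
rewrite leq_eqVlt => /orP[/eqP->|].
  by rewrite subrr big_geq // subr0; exact: pos0 HA.
rewrite ltnS => mn.
have -> : \sum_(m <= j < n.+1) b x j = \sum_(m <= j < n) b x j + b x n.
  by rewrite big_nat_recr.
have := posD HA (IH mn) (b_le x n); rewrite /T (ipBr HN); congr pos; lmod.
Qed.

Let b_pos x j : pos (b x j).
Proof. exact: pos_ip_mul HN _ _. Qed.

Let b_sum_pos x m n : pos (\sum_(m <= j < n) b x j).
Proof.
elim: n => [|n IH]; first by rewrite big_geq //; exact: pos0 HA.
have [mn|nm'] := leqP m n; first by rewrite big_nat_recr //=; exact: posD.
by rewrite big_geq //; exact: pos0 HA.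
Qed.

Let nm_b_tail x m n : (m <= n)%N -> nm (\sum_(m <= j < n) b x j) <= nm (q (nn m) x).
Proof.
move=> mn; apply: (nm_le_pos HA (b_sum_pos x m n)).
have := posD HA (b_tail x mn) (pos_op_pos (residual_pos HA HN gen (nn n)) x).
by congr pos; lmod.
Qed.

Let nn_ge j : (j <= nn j)%N.
Proof. by elim: j => // j IH; apply: leq_ltn_trans IH (nnS j). Qed.

Lemma block_admissible : admissible mul star ipN setT X.
Proof.
move=> x _; split=> [n|].
  rewrite /A_le.
  have -> : \sum_(i < n) mul (ipN x (X i)) (ipN (X i) x) = \sum_(0 <= j < n) b x j.
    by rewrite big_mkord.
  (* The blocks start at [S_0 = 1], so the telescoping sum starts at [<x, x>] itself. *)
  have q0 : q (nn 0) x = ipN x x by rewrite nn0.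
  have := posD HA (b_tail x (leq0n n)) (pos_op_pos (residual_pos HA HN gen (nn n)) x).
  by rewrite q0; congr pos; lmod.
have [e e0|l Hl] := @nm_cauchy_limit _ A (fun n => \sum_(i < n) b x i).
  have [n0 Hn0] := residual_form_cvg HA HN gen_dense x e0.
  exists n0 => n n0n; rewrite -!(big_mkord xpredT (b x)).
  rewrite (big_cat_nat (leq0n n0) n0n) addrAC subrr add0r.
  by apply: le_trans (nm_b_tail x n0n) _; apply: Hn0; exact: nn_ge.
exists l => _ /gt0_complexP[e e0 ->]; have [|n0 Hn0] := Hl (e / 2); first lra.
exists n0 => n /Hn0; rewrite nmE ltcR => /le_lt_trans; apply; lra.
Qed.

(** The square of this norm is that of one term [b x k], a tail of length one. *)
Lemma block_ip_cvg0 x (e : R) : 0 < e -> exists k0, forall k, (k0 <= k)%N ->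
  nm (ipN x (X k)) <= e.
Proof.
move=> e0; have [n0 Hn0] := residual_form_cvg HA HN gen_dense x (exprn_gt0 2 e0).
exists n0 => k n0k; rewrite -ler_sqr ?nnegrE ?nm_ge0 ?(ltW e0) //.
rewrite -(nm_ip_mul HA HN) -/(b x k).
have := nm_b_tail x (leqnSn k); rewrite big_nat1 => /le_trans; apply.
by apply: Hn0; exact: leq_trans n0k (nn_ge k).
Qed.

Lemma blocks_not_totally_bounded :
  ~ totally_bounded mul star ipN setT (F @` [set x : M | `|x| <= 1]).
Proof.
move=> [_ tb].
have /choice[Phi HPhi] : forall k, exists phi,
    is_state mul star phi /\ phi (h k) = (nm (h k))%:C.
  move=> k; apply: (exists_state HA (block_pos k)) => hk0.
  by have := block_nm k; rewrite hk0 nm0; have := sqr_ge0 d; lra.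
(* [Phi k] takes at [<F z_k, X_k>] a value of at least [s d^2 / 2], that is [4 eta]. A net element
   contributes at most [eta] for large [k] and closeness to it allows another [eta], which is too
   little. *)
pose eta : R := s * d ^+ 2 / 8.
have d20 : 0 < s * d ^+ 2 by rewrite mulr_gt0 ?exprn_gt0.
have eta0 : 0 < eta by rewrite /eta; lra.
have [|n [ys [ysY Hys]]] := tb X block_admissible Phi (fun k => (HPhi k).1) eta%:C.
  by rewrite ltcR.
have [k0 Hk0] : exists k0, forall k i, (k0 <= k)%N -> (i < n)%N -> nm (ipN (ys i) (X k)) <= eta.
  elim: n {ysY Hys} => [|n [k1 H1]]; first by exists 0%N.
  have [k2 H2] := block_ip_cvg0 (ys n) eta0.
  exists (maxn k1 k2) => k i; rewrite geq_max => /andP[k1k k2k].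
  rewrite ltnS leq_eqVlt => /orP[/eqP->|]; [exact: H2|exact: H1].
have [|i [ni [delta [dlt Hd]]]] := Hys (F (z k0)).
  by exists (z k0) => //=; rewrite nmE lecR.
(* Of the sum over [i >= k0] for the state [Phi k0], only the term [i = k0] is kept. *)
have := Hd k0 k0.+1; rewrite big_nat1 => {}Hd.
have Hstate := (HPhi k0).1.
have : cnorm (Phi k0 (ipN (ys i - F (z k0)) (X k0))) <= eta.
  rewrite -ler_sqr ?nnegrE ?cnorm_ge0 ?(ltW eta0) // -lecR !rmorphXn /= -cnormE.
  exact: le_trans Hd (ltW dlt).
rewrite (ipBl HA HN) (stateB Hstate) block_ip (stateZ Hstate) (HPhi k0).2 -rmorphM /=.
move=> H1; have := le_trans (state_norm Hstate _) (Hk0 k0 i (leqnn _) ni).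
set w := Phi k0 (ipN (ys i) (X k0)) in H1 *; move=> H2.
have : cnorm (s * nm (h k0))%:C <= cnorm w + cnorm (w - (s * nm (h k0))%:C).
  have := cnormD w (- (w - (s * nm (h k0))%:C)); rewrite subKr.
  by rewrite [X in _ <= _ + X -> _]/cnorm normrN.
rewrite cnorm_real ger0_norm ?mulr_ge0 ?nm_ge0 ?(ltW s_gt0) //.
have := ler_wpM2l (ltW s_gt0) (ltW (block_nm k0)).
move: H1 H2 eta0 {Hd dlt}; rewrite /eta; set v := s * nm (h k0); set u := cnorm (w - _).
move: (cnorm w) => cw; rewrite [s * (_ / _)]mulrA; lra.
Qed.
End Blocks.

Theorem totally_bounded_A_compact : countably_generated actN ->
  totally_bounded mul star ipN setT (F @` [set x : M | `|x| <= 1]) -> A_compact ipM actN F.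
Proof.
move=> [gen gen_dense] tb; apply: contrapT => nc.
have [C C0 FC] := operator_bound.
have [d d0 Hd] := not_compact_residual gen nc.
have d20 : 0 < d ^+ 2 / 2 by rewrite divr_gt0 ?exprn_gt0.
(* Given [n], first [z] with [|S_n F z| > d], then a larger index at which the form at [F z] has
   dropped to [d^2 / 2]. Iterating the second component gives the [n_j]. *)
have /choice[f Hf] : forall n, exists zm : M * nat, [/\ nm zm.1 <= 1, (n < zm.2)%N,
    d < nm (residual actN ipN gen n (F zm.1)) &
    nm (ipN (F zm.1) (residual actN ipN gen zm.2 (F zm.1))) <= d ^+ 2 / 2].
  move=> n; have [z [z1 zd]] := Hd n.
  have [m Hm] := residual_form_cvg HA HN gen_dense (F z) d20.
  by exists (z, maxn n.+1 m); split=> //=; [rewrite leq_maxl|apply: Hm; rewrite leq_maxr].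
pose nn j := iter j (fun n => (f n).2) 0%N.
apply: (@blocks_not_totally_bounded gen gen_dense C C0 FC d (fun j => (f (nn j)).1) nn d0) => //.
- by move=> j; case: (Hf (nn j)).
- by move=> j; case: (Hf (nn j)).
- by move=> j; case: (Hf (nn j)).
- by move=> j; case: (Hf (nn j)).
Qed.
End Converse.

(** * Compact implies totally bounded *)

Section FiniteNets.
Variable Z : Type.

(** One representative in [B] is picked for each attained code and [z0] stands in for the others, so
    that the net stays inside [B]. *)
Lemma finite_code_net (T : finType) (B : Z -> Prop) (code : Z -> T) z0 : B z0 ->
  exists (n : nat) (zs : nat -> Z), (forall j, (j < n)%N -> B (zs j)) /\
    forall z, B z -> exists j, (j < n)%N /\ code (zs j) = code z.
Proof.
move=> Bz0.
have /choice[rep Hrep] : forall t, exists z, B z /\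
    ((exists2 z', B z' & code z' = t) -> code z = t).
  move=> t; have [[z Bz zt]|nz] := pselect (exists2 z', B z' & code z' = t); first by exists z.
  by exists z0.
exists (size (enum T)), (nth z0 (map rep (enum T))); split=> [j jn|z Bz].
  by rewrite (nth_map (code z0)) //; exact: (Hrep _).1.
have zT : code z \in enum T by rewrite mem_enum.
exists (index (code z) (enum T)); split; first by rewrite index_mem.
rewrite (nth_map (code z)) ?index_mem // nth_index //.
by apply: (Hrep _).2; exists z.
Qed.

(** The range from [- b] to [b] of each coordinate is cut into cells of length [eta]; the code of a
    point lists its cells. *)
Lemma finite_net (R : realType) (I : finType) (f : I -> Z -> R) (B : Z -> Prop) (b eta : R) z0 :
  B z0 -> 0 < eta -> (forall i z, B z -> `|f i z| <= b) ->
  exists (n : nat) (zs : nat -> Z), (forall j, (j < n)%N -> B (zs j)) /\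
    forall z, B z -> exists j, (j < n)%N /\ forall i, `|f i (zs j) - f i z| <= eta.
Proof.
move=> Bz0 eta0 fb.
pose cell i z := Num.truncn ((f i z + b) / eta).
pose K := Num.truncn ((b + b) / eta).
have cell_ge0 i z : B z -> 0 <= (f i z + b) / eta.
  move=> /(fb i); rewrite ler_norml => /andP[H _].
  by apply: divr_ge0; [move: H; lra|exact: ltW].
have cellK i z : B z -> (cell i z < K.+1)%N.
  move=> Bz; rewrite ltnS; apply: le_truncn; rewrite ler_pM2r ?invr_gt0 // lerD2r.
  by have := fb i z Bz; rewrite ler_norml => /andP[].
pose code z : {ffun I -> 'I_K.+1} := [ffun i => inord (cell i z)].
have [n [zs [zsB H]]] := finite_code_net code Bz0.
exists n, zs; split=> // z Bz; have [j [jn /ffunP Hj]] := H z Bz.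
exists j; split=> // i.
have K1 := cellK i z Bz; have K2 := cellK i (zs j) (zsB j jn).
have := congr1 val (Hj i); rewrite !ffunE /= !inordK // => E.
have /andP[L1 U1] := truncn_itv (cell_ge0 i z Bz).
have /andP[L2 U2] := truncn_itv (cell_ge0 i (zs j) (zsB j jn)).
rewrite -/(cell i z) in L1 U1; rewrite -/(cell i (zs j)) E in L2 U2.
move: L1 U1 L2 U2; rewrite -natr1 ler_pdivlMr // ltr_pdivrMr // ler_pdivlMr // ltr_pdivrMr //.
rewrite mulrDl mul1r; set c := _ * eta => L1 U1 L2 U2.
by rewrite ler_norml; apply/andP; split; move: L1 U1 L2 U2; lra.
Qed.
End FiniteNets.

Section NonnegativeSums.
Variables (R : realType) (c : nat -> R).
Hypothesis c0 : forall i, 0 <= c i.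

Lemma sum_nat_ge0 m n : 0 <= \sum_(m <= i < n) c i.
Proof. by apply: sumr_ge0. Qed.

Lemma sum_nat_tail_le k l n : (k <= l)%N -> \sum_(l <= i < n) c i <= \sum_(k <= i < n) c i.
Proof.
move=> kl; have [ln|nl] := leqP l n.
  by rewrite [X in _ <= X](big_cat_nat kl ln) lerDr sum_nat_ge0.
by rewrite big_geq ?sum_nat_ge0 // ltnW.
Qed.

Lemma sum_nat_split_le k0 k n :
  \sum_(k <= i < n) c i <= \sum_(k <= i < k0) c i + \sum_(k0 <= i < n) c i.
Proof.
have [k0k|kk0] := leqP k0 k.
  by apply: le_trans (sum_nat_tail_le n k0k) _; rewrite lerDr sum_nat_ge0.
have [k0n|nk0] := leqP k0 n; first by rewrite (big_cat_nat (ltnW kk0) k0n).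
rewrite [X in _ + X]big_geq ?(ltnW nk0) // addr0.
have [kn|nk] := leqP k n; last by rewrite big_geq ?sum_nat_ge0 // ltnW.
by rewrite [X in _ <= X](big_cat_nat kn (ltnW nk0)) lerDl sum_nat_ge0.
Qed.
End NonnegativeSums.

Lemma cnormD_sqr_le (R : realType) (k l : R[i]) :
  cnorm (k + l) ^+ 2 <= 2 * cnorm k ^+ 2 + 2 * cnorm l ^+ 2.
Proof.
apply: (@le_trans _ _ ((cnorm k + cnorm l) ^+ 2)).
  by rewrite ler_sqr ?nnegrE ?addr_ge0 ?cnorm_ge0 // cnormD.
by have := sqr_ge0 (cnorm k - cnorm l); nra.
Qed.

Section Forward.
Variables (R : realType) (A : completeNormedModType R[i]).
Variables (mul : A -> A -> A) (star : A -> A).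
Hypothesis HA : is_CStar_algebra mul star.
Variables (M N : completeNormedModType R[i]).
Variables (actM : M -> A -> M) (ipM : M -> M -> A).
Variables (actN : N -> A -> N) (ipN : N -> N -> A).
Hypothesis HM : is_Hilbert_module mul star actM ipM.
Hypothesis HN : is_Hilbert_module mul star actN ipN.
Variable X : nat -> N.
Hypothesis HX : admissible mul star ipN setT X.
Local Notation pos := (A_pos mul star).
Local Notation state := (is_state mul star).

Let b u i := mul (ipN u (X i)) (ipN (X i) u).
Let c phi u i : R := cnorm (phi (ipN u (X i))) ^+ 2.

Let c_ge0 phi u i : 0 <= c phi u i.
Proof. exact: sqr_ge0. Qed.

Let c_le_Re phi u m n : state phi ->
  \sum_(m <= i < n) c phi u i <= complex.Re (phi (\sum_(m <= i < n) b u i)).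
Proof.
move=> Hphi; rewrite (state_sum Hphi) raddf_sum; apply: ler_sum => i _.
by have := state_sqr HA Hphi (ipN u (X i)); rewrite -(hm_ipC HN).
Qed.

Let c_le_nm phi u m n : state phi ->
  \sum_(m <= i < n) c phi u i <= nm (\sum_(m <= i < n) b u i).
Proof. by move=> Hphi; apply: le_trans (c_le_Re u m n Hphi) (state_Re_norm Hphi _). Qed.

Let c_le_sqr phi u m n : state phi -> \sum_(m <= i < n) c phi u i <= nm u ^+ 2.
Proof.
move=> Hphi; apply: le_trans (sum_nat_tail_le (c_ge0 phi u) n (leq0n m)) _.
apply: le_trans (c_le_Re u 0 n Hphi) _; rewrite -(nm_ip HN).
apply: le_trans (state_Re_norm Hphi _); have := (HX (x := u) I).1 n.
rewrite /A_le -(big_mkord xpredT (b u)) => /(state_Re_pos Hphi).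
by rewrite (stateB Hphi) raddfB subr_ge0.
Qed.

Let b_tail u (e : R) : 0 < e -> exists k0, forall n, nm (\sum_(k0 <= i < n) b u i) <= e.
Proof.
move=> e0; have [_ [l Hl]] := HX (x := u) I.
have [|k0 Hk0] := Hl (e / 2)%:C; first by rewrite ltcR; lra.
exists k0 => n; have [k0n|nk0] := leqP k0 n; last by rewrite big_geq ?nm0 ?ltW // ltnW.
have := Hk0 n k0n; have := Hk0 k0 (leqnn _); rewrite !nmE !ltcR.
rewrite -!(big_mkord xpredT (b u)) => H1 H2.
have -> : \sum_(k0 <= i < n) b u i =
    (\sum_(0 <= i < n) b u i - l) - (\sum_(0 <= i < k0) b u i - l).
  have -> : \sum_(0 <= i < n) b u i = \sum_(0 <= i < k0) b u i + \sum_(k0 <= i < n) b u i.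
    by rewrite -big_cat_nat.
  lmod.
apply: le_trans (nmB _ _) _; move: H1 H2; lra.
Qed.

Definition uniform_tails (K : M -> N) : Prop :=
  forall e : R, 0 < e -> exists k0, forall z, nm z <= 1 -> forall phi, state phi ->
    forall n, \sum_(k0 <= i < n) c phi (K z) i <= e.

(** For [a = <y, z>] the tail of the series at [x a] is [a^* t a], with [t] the tail at [x], which
    does not involve [z]; and [|a| <= |y|] on the unit ball. *)
Lemma uniform_tails_theta x y : uniform_tails (fun z => actN x (ipM y z)).
Proof.
move=> e e0; pose d := nm y ^+ 2 + 1.
have d0 : 0 < d by rewrite ltr_wpDl // sqr_ge0.
have [|k0 Hk0] := b_tail x (e := e / d); first by rewrite divr_gt0.
exists k0 => z z1 phi Hphi n; set a := ipM y z.
apply: le_trans (c_le_nm _ _ _ Hphi) _.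
have -> : \sum_(k0 <= i < n) b (actN x a) i =
    mul (star a) (mul (\sum_(k0 <= i < n) b x i) a).
  rewrite (big_morph (fun t => mul (star a) (mul t a))
    (fun t t' => etrans (congr1 _ (cs_mulDl HA t t' a)) (cs_mulDr HA _ _ _))
    (etrans (congr1 _ (mul0a HA a)) (mula0 HA _))).
  by apply: eq_bigr => i _; rewrite /b (ipAl HA HN) (hm_ipAr HN) !(cs_mulA HA).
have a1 : nm a <= nm y.
  by apply: le_trans (nm_ip_le HA HM y z) _; rewrite ler_piMr ?nm_ge0.
apply: le_trans (nmM HA _ _) _; rewrite (nm_star HA).
have H1 := le_trans (nmM HA _ a) (ler_pM (nm_ge0 _) (nm_ge0 a) (Hk0 n) a1).
apply: le_trans (ler_pM (nm_ge0 a) (nm_ge0 _) a1 H1) _.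
have -> : nm y * (e / d * nm y) = e * (nm y ^+ 2 / d) by ring.
by rewrite ler_piMr ?(ltW e0) // ler_pdivrMr // mul1r /d lerDl.
Qed.

Lemma uniform_tailsD K L : uniform_tails K -> uniform_tails L ->
  uniform_tails (fun z => K z + L z).
Proof.
move=> HK HL e e0.
have [|k1 H1] := HK (e / 4); first lra.
have [|k2 H2] := HL (e / 4); first lra.
exists (maxn k1 k2) => z z1 phi Hphi n.
have G1 := le_trans (sum_nat_tail_le (c_ge0 phi (K z)) n (leq_maxl k1 k2)) (H1 z z1 phi Hphi n).
have G2 := le_trans (sum_nat_tail_le (c_ge0 phi (L z)) n (leq_maxr k1 k2)) (H2 z z1 phi Hphi n).
have : \sum_(maxn k1 k2 <= i < n) c phi (K z + L z) i <=
    2 * \sum_(maxn k1 k2 <= i < n) c phi (K z) i + 2 * \sum_(maxn k1 k2 <= i < n) c phi (L z) i.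
  rewrite !mulr_sumr -big_split /=; apply: ler_sum => i _.
  by rewrite /c (ipDl HA HN) (stateD Hphi); exact: cnormD_sqr_le.
by move: G1 G2; lra.
Qed.

Lemma uniform_tails_theta_sum n (xs : nat -> N) (ys : nat -> M) :
  uniform_tails (fun z => \sum_(i < n) actN (xs i) (ipM (ys i) z)).
Proof.
elim: n => [|n IH] e e0.
  exists 0%N => z _ phi Hphi k; apply: le_trans (c_le_sqr _ _ _ Hphi) _.
  by rewrite big_ord0 nm0 expr0n /= ltW.
have [k0 Hk0] := uniform_tailsD IH (uniform_tails_theta (xs n) (ys n)) e0.
exists k0 => z z1 phi Hphi k; rewrite big_ord_recr /=; exact: Hk0.
Qed.

(** A finite sum [K] of [theta] operators has uniform tails, and [F - K] is handled at every index
    by the Bessel-type bound [c_le_sqr]. The quarters of [e] pay for the factor 2 in squaring a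
    sum. *)
Lemma uniform_tails_compact F : A_compact ipM actN F -> uniform_tails F.
Proof.
move=> HF e e0; pose r := Num.sqrt (e / 4).
have r0 : 0 < r by rewrite sqrtr_gt0; lra.
have [|n [xs [ys H]]] := HF r%:C; first by rewrite ltcR.
have [|k0 Hk0] := @uniform_tails_theta_sum n xs ys (e / 4); first lra.
exists k0 => z z1 phi Hphi m; pose K z := \sum_(i < n) actN (xs i) (ipM (ys i) z).
have G : \sum_(k0 <= i < m) c phi (K z) i <= e / 4 by exact: Hk0.
have w1 : nm (F z - K z) ^+ 2 <= e / 4.
  have -> : e / 4 = r ^+ 2 by rewrite sqr_sqrtr //; lra.
  rewrite ler_sqr ?nnegrE ?nm_ge0 ?(ltW r0) //.
  by have := H z; rewrite !nmE -rmorphM lecR /= => /le_trans; apply; rewrite ler_piMr ?(ltW r0).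
have : \sum_(k0 <= i < m) c phi (F z) i <=
    2 * \sum_(k0 <= i < m) c phi (F z - K z) i + 2 * \sum_(k0 <= i < m) c phi (K z) i.
  rewrite !mulr_sumr -big_split /=; apply: ler_sum => i _.
  have -> : c phi (F z) i =
      cnorm (phi (ipN (F z - K z) (X i)) + phi (ipN (K z) (X i))) ^+ 2.
    by rewrite -(stateD Hphi) -(ipDl HA HN) subrK.
  exact: cnormD_sqr_le.
have := le_trans (c_le_sqr (F z - K z) k0 m Hphi) w1.
by move: G; lra.
Qed.

Lemma uniform_tails_net F (Phi : nat -> A -> R[i]) (r C : R) :
  (forall k, state (Phi k)) -> uniform_tails F -> 0 < r -> F 0 = 0 ->
  (forall z, nm z <= 1 -> nm (F z) <= C) ->
  exists (n : nat) (zs : nat -> M), (forall j, (j < n)%N -> nm (zs j) <= 1) /\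
    forall z, nm z <= 1 -> exists j, (j < n)%N /\
      forall k m, \sum_(k <= i < m) c (Phi k) (F (zs j) - F z) i <= r ^+ 2 / 2.
Proof.
move=> HPhi HF r0 F0 FC.
have C0 : 0 <= C by have := FC 0; rewrite nm0 F0 nm0; apply.
have [|k0 Hk0] := HF (r ^+ 2 / 16); first by rewrite divr_gt0 ?exprn_gt0.
(* For [k >= k0] the whole sum from [k] lies in the uniform tail; for [k < k0] only indices [i < k0]
   lie outside it. The boolean selects real or imaginary part. *)
pose f (p : 'I_k0 * 'I_k0 * bool) z : R :=
  let w := Phi p.1.1 (ipN (F z) (X p.1.2)) in if p.2 then complex.Re w else complex.Im w.
pose B := C * \sum_(i < k0) nm (X i).
have fB p z : nm z <= 1 -> `|f p z| <= B.
  move=> z1; apply: (@le_trans _ _ (cnorm (Phi p.1.1 (ipN (F z) (X p.1.2))))).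
    by rewrite /f; case: (p.2); [exact: cnorm_ge_Re|exact: cnorm_ge_Im].
  apply: le_trans (state_norm (HPhi _) _) _; apply: le_trans (nm_ip_le HA HN _ _) _.
  apply: ler_pM; rewrite ?nm_ge0 ?FC //.
  by rewrite (bigD1 p.1.2) //= lerDl sumr_ge0 // => *; exact: nm_ge0.
(* The head has at most [k0] terms, each at most [2 eta^2], in total at most [r^2 / 8]; the tail
   adds [r^2 / 4]. The successor keeps the divisor positive when [k0 = 0]. *)
pose eta := r / (4 * k0.+1%:R).
have k1 : 1 <= k0.+1%:R :> R by rewrite ler1n.
have eta0 : 0 < eta by rewrite divr_gt0 // mulr_gt0.
have [|n [zs [zs1 Hzs]]] := @finite_net M R _ f (fun z => nm z <= 1) B eta 0 _ eta0 fB.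
  by rewrite nm0.
exists n, zs; split=> // z z1; have [j [jn Hj]] := Hzs z z1; exists j; split=> // k m.
apply: le_trans (sum_nat_split_le (c_ge0 _ _) k0 _ _) _.
have head : \sum_(k <= i < k0) c (Phi k) (F (zs j) - F z) i <= r ^+ 2 / 8.
  have [k0k|kk0] := leqP k0 k; first by rewrite big_geq // divr_ge0 ?sqr_ge0.
  apply: (@le_trans _ _ (\sum_(k <= i < k0) 2 * eta ^+ 2)).
    apply: ler_sum_nat => i /andP[_ ik0].
    have := Hj (Ordinal kk0, Ordinal ik0, true); have := Hj (Ordinal kk0, Ordinal ik0, false).
    rewrite /f /= /c (ipBl HA HN) (stateB (HPhi k)) cnorm_sqr !raddfB /=.
    rewrite -[X in _ -> _ -> X + _ <= _]real_normK ?num_real //.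
    rewrite -[X in _ -> _ -> _ + X <= _]real_normK ?num_real //.
    move: (normr_ge0 (complex.Re (Phi k (ipN (F (zs j)) (X i))) - complex.Re (Phi k (ipN (F z) (X i))))).
    move: (normr_ge0 (complex.Im (Phi k (ipN (F (zs j)) (X i))) - complex.Im (Phi k (ipN (F z) (X i))))).
    move: `|_| `|_| => u v u0 v0 ue ve.
    have := lerXn2r 2 u0 (ltW eta0) ue; have := lerXn2r 2 v0 (ltW eta0) ve; lra.
  rewrite sumr_const_nat -[_ *+ (k0 - k)]mulr_natl.
  apply: (@le_trans _ _ (k0.+1%:R * (2 * eta ^+ 2))).
    apply: ler_wpM2r; first by rewrite mulr_ge0 ?sqr_ge0.
    by rewrite ler_nat (leq_trans (leq_subr _ _)).
  have -> : k0.+1%:R * (2 * eta ^+ 2) = r ^+ 2 / 8 / k0.+1%:R.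
    have L0 : k0.+1%:R != 0 :> R by rewrite pnatr_eq0.
    by rewrite /eta; move: (k0.+1%:R : R) L0 => L L0; field.
  by rewrite ler_pdivrMr ?ltr0n // ler_peMr // divr_ge0 ?sqr_ge0.
have tail : \sum_(k0 <= i < m) c (Phi k) (F (zs j) - F z) i <= r ^+ 2 / 4.
  have H1 : \sum_(k0 <= i < m) c (Phi k) (F z) i <= r ^+ 2 / 16.
    exact: Hk0 z z1 _ (HPhi k) m.
  have H2 : \sum_(k0 <= i < m) c (Phi k) (F (zs j)) i <= r ^+ 2 / 16.
    exact: Hk0 _ (zs1 j jn) _ (HPhi k) m.
  have : \sum_(k0 <= i < m) c (Phi k) (F (zs j) - F z) i <=
      2 * \sum_(k0 <= i < m) c (Phi k) (F (zs j)) i + 2 * \sum_(k0 <= i < m) c (Phi k) (F z) i.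
    rewrite !mulr_sumr -big_split /=; apply: ler_sum => i _.
    rewrite /c (ipBl HA HN) (stateB (HPhi k)); apply: le_trans (cnormD_sqr_le _ _) _.
    by rewrite [cnorm (- _)]/cnorm normrN.
  by move: H1 H2; lra.
by have := sqr_ge0 r; move: head tail; lra.
Qed.
End Forward.

Theorem A_compact_totally_bounded (R : realType) (A : completeNormedModType R[i])
    (mul : A -> A -> A) (star : A -> A)
    (M N : completeNormedModType R[i])
    (actM : M -> A -> M) (ipM : M -> M -> A)
    (actN : N -> A -> N) (ipN : N -> N -> A) (F : M -> N) :
  is_CStar_algebra mul star ->
  is_Hilbert_module mul star actM ipM ->
  is_Hilbert_module mul star actN ipN ->
  adjointable_operator actM ipM actN ipN F ->
  A_compact ipM actN F ->
  totally_bounded mul star ipN setT (F @` [set x : M | `|x| <= 1]).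
Proof.
move=> HA HM HN HF Fc; split=> // X HX Phi HPhi _ /gt0_complexP[r r0 ->].
have [C C0 FC] := operator_bound HF.
have FC1 z : nm z <= 1 -> nm (F z) <= C.
  by move=> z1; apply: le_trans (FC z) _; rewrite ler_piMr.
have [n [zs [zs1 Hzs]]] := uniform_tails_net HA HN HPhi
  (uniform_tails_compact HA HM HN HX Fc) r0 (operator0 HF) FC1.
exists n, (F \o zs); split=> [i ni|_ [z z1 <-]].
  by exists (zs i) => //=; rewrite nmE lecR zs1.
have [|j [jn Hj]] := Hzs z; first by move: z1; rewrite /= nmE lecR.
exists j; split=> //; exists (r ^+ 2 / 2)%:C; split.
  by rewrite -rmorphXn ltcR; have := exprn_gt0 2 r0; lra.
move=> k m; apply: le_trans (_ : (\sum_(k <= i < m)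
    cnorm (Phi k (ipN (F (zs j) - F z) (X i))) ^+ 2)%:C <= _); last by rewrite lecR.
by rewrite rmorph_sum /=; apply: ler_sum => i _; rewrite cnormE rmorphXn.
Qed.

Theorem theorem2p5 (R : realType) (A : completeNormedModType R[i])
    (mul : A -> A -> A) (star : A -> A)
    (M N : completeNormedModType R[i])
    (actM : M -> A -> M) (ipM : M -> M -> A)
    (actN : N -> A -> N) (ipN : N -> N -> A) (F : M -> N) :
  is_CStar_algebra mul star ->
  is_Hilbert_module mul star actM ipM ->
  is_Hilbert_module mul star actN ipN ->
  countably_generated actN ->
  adjointable_operator actM ipM actN ipN F ->
  (A_compact ipM actN F <->
   totally_bounded mul star ipN setT (F @` [set x : M | `|x| <= 1])).
Proof.
move=> HA HM HN HNg HF; split; first exact: (A_compact_totally_bounded HA HM HN HF).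
exact: (totally_bounded_A_compact HA HM HN HF HNg).
Qed.
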